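(* There are a set $\Theta$ of $7$ formulas of the kinds listed in the context, and a function $\mathtt{forces}$ defined by primitive recursion on formulas that expresses, in the language $\{\in\}$, the forcing relation defined in the context, such that the following holds. Let $M$ be a countable transitive set with $\langle M,\in\rangle\models \mathrm{Z}\cup\{\mathrm{Replacement}(\chi):\chi\in\Theta\}$, and let $\langle\mathbb P,\preceq,\mathbb 1\rangle$ be a forcing notion with $\mathbb P,{\preceq}\in M$. For every formula $\varphi$ with $\mathrm{arity}(\varphi)\le n$ and all $\tau_1,\dots,\tau_n\in M$: 1. (Definability) $\mathtt{forces}(\varphi)$ is a formula, and its arity is at most $\mathrm{arity}(\varphi)+4$. Moreover, writing ''$p\Vdash\varphi\ [\tau_1,\dots,\tau_n]$'' for ''$M,[p,\mathbb P,\preceq,\mathbb 1,\tau_1,\dots,\tau_n]\models\mathtt{forces}(\varphi)$'': 2. (Truth Lemma) for every $M$-generic filter $G\subseteq\mathbb P$, $$\exists p\in G.\ p\Vdash\varphi\ [\tau_1,\dots,\tau_n]\quad\Longleftrightarrow\quad M[G],[\mathrm{val}(G,\tau_1),\dots,\mathrm{val}(G,\tau_n)]\models\varphi .$$ 3. (Density Lemma) for every $p\in\mathbb P$, $p\Vdash\varphi\ [\tau_1,\dots,\tau_n]$ if and only if $\{q\in\mathbb P: q\Vdash\varphi\ [\tau_1,\dots,\tau_n]\}$ is dense below $p$.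
   Context: The background theory is $\mathit{ZF}$. ''Formula'' means a first-order formula in the language $\{\in\}$ coded as a set, with variables given by de Bruijn indices, built from atomic formulas $x\in y$, $x=y$ by $\neg(\cdot\wedge\cdot)$ and $\forall$. $\mathrm{arity}(\varphi)$ is one plus the maximum free index of $\varphi$ ($0$ if there is none). $M,[a_0,\dots,a_{k-1}]\models\varphi$ means that $\langle M,\in\rangle$ satisfies $\varphi$ when free index $i$ is assigned $a_i$. $\mathrm{Z}$ (Zermelo set theory, with Foundation) consists of Extensionality, Foundation, Pairing, Union, Infinity, Powerset and all instances of Separation (with parameters). For a formula $\varphi(x,y,\vec z)$, $\mathrm{Replacement}(\varphi)$ is the sentence: for all $\vec z$ and every set $A$, if for each $x\in A$ there is at most one $y$ with $\varphi(x,y,\vec z)$, then there is a set $Y$ such that for all $b$, $b\in Y\leftrightarrow\exists x\in A\ \varphi(x,b,\vec z)$. The $7$ formulas in $\Theta$ are: (1) the replacement giving closure under iteration of $X\mapsto\bigcup X$ (along $n\mapsto\bigcup^nX$, $n\in\omega$); (2) an auxiliary one for absoluteness of this construction; (3) the well-founded recursion defining $\in$-rank; (4) the transfinite recursion defining the cumulative hierarchy; (5) the well-founded recursion defining check-names $\check x=\{\langle\check y,\mathbb 1\rangle:y\in x\}$; (6) the well-founded recursion defining forcing for atomic formulas; (7) replacement through $x\mapsto\langle x,\check x\rangle$. A forcing notion $\langle\mathbb P,\preceq,\mathbb 1\rangle$ is a preorder $\preceq$ on $\mathbb P$ with $\mathbb 1\in\mathbb P$ and $p\preceq\mathbb 1$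 for all $p\in\mathbb P$. A filter $G\subseteq\mathbb P$ is $M$-generic if it meets every dense subset of $\mathbb P$ belonging to $M$. A set $D$ is dense below $p$ if for every $q\preceq p$ in $\mathbb P$ there is $d\in D$ with $d\preceq q$. Every element of $M$ is regarded as a name: $\mathrm{val}(G,\tau)=\{\mathrm{val}(G,\sigma):\exists r\in G\ \langle\sigma,r\rangle\in\tau\}$ by well-founded recursion, and $M[G]=\{\mathrm{val}(G,\tau):\tau\in M\}$. Write $\mathrm{dom}(\tau)=\{\sigma:\exists r\ \langle\sigma,r\rangle\in\tau\}$. The forcing relation expressed by $\mathtt{forces}$ (interpreted in $M$, for $p\in\mathbb P$ and $q$ ranging over $\mathbb P$) is: - $p\Vdash \tau_1=\tau_2$ iff for all $\sigma\in\mathrm{dom}(\tau_1)\cup\mathrm{dom}(\tau_2)$ and all $q\preceq p$: $q\Vdash\sigma\in\tau_1\leftrightarrow q\Vdash\sigma\in\tau_2$; - $p\Vdash\tau_1\in\tau_2$ iff $\{q\preceq p:\exists\langle\sigma,r\rangle\in\tau_2\ (q\preceq r\wedge q\Vdash\tau_1=\sigma)\}$ is dense below $p$; - $p\Vdash\neg(\varphi\wedge\psi)$ iff there is no $q\preceq p$ with $q\Vdash\varphi$ and $q\Vdash\psi$; - $p\Vdash\forall x\,\varphi$ iff $p\Vdash\varphi[\tau,\dots]$ for all $\tau\in M$. *)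

(* Defs.v *)
From Stdlib Require Import List Arith Lia Wellfounded.
From Stdlib Require Import Classical ClassicalEpsilon FunctionalExtensionality.
Import ListNotations.

(** * ZF universes

    Replacement is schematic in an arbitrary relation of the metatheory.  In
    particular the natural numbers of such a universe are the standard ones,
    and [mem] is well-founded ([mem_wf] below). *)

Record ZF : Type := {
  carrier :> Type;
  mem : carrier -> carrier -> Prop;
  zf_extensionality : forall x y,
    (forall z, mem z x <-> mem z y) -> x = y;
  zf_foundation : forall x, (exists y, mem y x) ->
    exists y, mem y x /\ ~ exists z, mem z x /\ mem z y;
  zf_pairing : forall a b, exists c, forall x, mem x c <-> x = a \/ x = b;
  zf_union : forall a, exists u, forall x,
    mem x u <-> exists y, mem y a /\ mem x y;
  zf_powerset : forall a, exists p, forall x,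
    mem x p <-> forall z, mem z x -> mem z a;
  zf_infinity : exists I,
    (exists e, mem e I /\ forall z, ~ mem z e) /\
    (forall x, mem x I ->
       exists s, mem s I /\ forall z, mem z s <-> mem z x \/ z = x);
  zf_replacement : forall (R : carrier -> carrier -> Prop) A,
    (forall x, mem x A -> forall y y', R x y -> R x y' -> y = y') ->
    exists Y, forall b, mem b Y <-> exists x, mem x A /\ R x b
}.

Arguments mem {z} _ _ : rename.
Notation "x ∈ y" := (mem x y) (at level 70).

Lemma ZF_inhabited (V : ZF) : inhabited V.
Proof. destruct (zf_infinity V) as [I _]. exact (inhabits I). Qed.

(** [setof P] is the set {x | P x}; it is unspecified when P is a proper
    class. *)
Definition setof {V : ZF} (P : V -> Prop) : V :=
  epsilon (ZF_inhabited V) (fun c => forall x, x ∈ c <-> P x).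

Section Sets.
Context {V : ZF}.
Implicit Types a b x y z f r : V.

Definition empty : V := setof (fun _ => False).
Definition upair a b : V := setof (fun x => x = a \/ x = b).
Definition opair a b : V := upair (upair a a) (upair a b).
Definition bigcup a : V := setof (fun x => exists y, y ∈ a /\ x ∈ y).
Definition succ a : V := setof (fun x => x ∈ a \/ x = a).

Fixpoint numeral (k : nat) : V :=
  match k with 0 => empty | S k => succ (numeral k) end.

Definition in_dom (s t : V) : Prop := exists r, opair s r ∈ t.

Definition transitive_set (M : V) : Prop :=
  forall x y, x ∈ M -> y ∈ x -> y ∈ M.

Definition countable_set (M : V) : Prop :=
  exists e : nat -> V, forall x, x ∈ M -> exists n, e n = x.

Lemma setofP (P : V -> Prop) :
  (exists c, forall x, x ∈ c <-> P x) -> forall x, x ∈ setof P <-> P x.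
Proof. intro H. exact (epsilon_spec (ZF_inhabited V) _ H). Qed.

Lemma separation (P : V -> Prop) a :
  exists c, forall x, x ∈ c <-> x ∈ a /\ P x.
Proof.
  destruct (zf_replacement V (fun x y => x = y /\ P x) a) as [c Hc].
  - intros x _ y y' [<- _] [<- _]. reflexivity.
  - exists c. intro x. rewrite Hc. split.
    + intros [y [Hy [<- HP]]]. auto.
    + intros [Hx HP]. exists x. auto.
Qed.

Lemma emptyP x : ~ x ∈ empty.
Proof.
  destruct (zf_infinity V) as [I [[e [_ He]] _]].
  unfold empty. rewrite setofP; [tauto |].
  exists e. intro z. split; [apply He | tauto].
Qed.

Lemma upairP a b x : x ∈ upair a b <-> x = a \/ x = b.
Proof. apply (setofP (fun x => x = a \/ x = b)), zf_pairing. Qed.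

Lemma bigcupP a x : x ∈ bigcup a <-> exists y, y ∈ a /\ x ∈ y.
Proof. apply (setofP (fun x => exists y, y ∈ a /\ x ∈ y)), zf_union. Qed.

Lemma succP a x : x ∈ succ a <-> x ∈ a \/ x = a.
Proof.
  apply (setofP (fun x => x ∈ a \/ x = a)).
  exists (bigcup (upair a (upair a a))). intro z.
  rewrite bigcupP. split.
  - intros [y [Hy Hz]]. apply upairP in Hy. destruct Hy; subst y; [tauto |].
    apply upairP in Hz. tauto.
  - intros [H | ->].
    + exists a. rewrite upairP. tauto.
    + exists (upair a a). rewrite !upairP. tauto.
Qed.

Lemma opair_inj a b a' b' : opair a b = opair a' b' -> a = a' /\ b = b'.
Proof.
  unfold opair. intro H.
  assert (E : forall w, (w = upair a a \/ w = upair a b) <->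
                        (w = upair a' a' \/ w = upair a' b')).
  { intro w. rewrite <- !upairP. rewrite H. tauto. }
  assert (U : forall c d c' d' : V, upair c d = upair c' d' ->
            (c = c' \/ c = d') /\ (d = c' \/ d = d') /\
            (c' = c \/ c' = d) /\ (d' = c \/ d' = d)).
  { intros c d c' d' K.
    assert (L : forall w, (w = c \/ w = d) <-> (w = c' \/ w = d')).
    { intro w. rewrite <- !upairP. rewrite K. tauto. }
    repeat split; apply L; tauto. }
  assert (A : a = a').
  { destruct (proj1 (E _) (or_introl eq_refl)) as [K | K];
      apply U in K; intuition congruence. }
  subst a'. split; [reflexivity |].
  destruct (proj1 (E _) (or_intror eq_refl)) as [K | K];
  destruct (proj2 (E _) (or_intror eq_refl)) as [K' | K'];
    apply U in K; apply U in K'; intuition congruence.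
Qed.

Lemma mem_irrefl x : ~ x ∈ x.
Proof.
  intro H. destruct (zf_foundation V (upair x x)) as [y [Hy N]].
  - exists x. rewrite upairP. tauto.
  - apply upairP in Hy. assert (y = x) by tauto. subst y.
    apply N. exists x. rewrite upairP. tauto.
Qed.

Lemma numeral_lt k l : k < l -> numeral k ∈ numeral l.
Proof.
  induction 1; simpl; rewrite succP; tauto.
Qed.

Lemma numeral_inj k l : numeral k = numeral l -> k = l.
Proof.
  intro E. destruct (Nat.lt_total k l) as [H | [H | H]]; [| exact H |];
    apply numeral_lt in H; rewrite E in H; destruct (mem_irrefl _ H).
Qed.

Lemma range_nat (e : nat -> V) : exists Y, forall y, y ∈ Y <-> exists k, y = e k.
Proof.
  destruct (zf_infinity V) as [I [[o [Ho Eo]] HS]].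
  assert (N : forall k, numeral k ∈ I).
  { induction k as [| k IH]; simpl.
    - replace empty with o; [exact Ho |]. apply zf_extensionality. intro z.
      generalize (Eo z) (emptyP z). tauto.
    - destruct (HS _ IH) as [s [Hs Es]].
      replace (succ (numeral k)) with s; [exact Hs |].
      apply zf_extensionality. intro z. rewrite Es, succP. tauto. }
  destruct (zf_replacement V
    (fun n y => exists k, n = numeral k /\ y = e k) I) as [Y HY].
  - intros n _ y y' [k [-> ->]] [l [E ->]].
    apply numeral_inj in E. congruence.
  - exists Y. intro y. rewrite HY. split.
    + intros [n [_ [k [_ ->]]]]. eauto.
    + intros [k ->]. exists (numeral k). eauto.
Qed.

Lemma mem_wf : well_founded (fun x y : V => x ∈ y).
Proof.
  intro a. apply NNPP. intro Na.
  destruct (range_nat (fun k => Nat.iter k bigcup (upair a a))) as [Y HY].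
  destruct (separation (fun y => ~ Acc (fun x y : V => x ∈ y) y) (bigcup Y))
    as [B HB].
  destruct (zf_foundation V B) as [y [Hy N]].
  - exists a. rewrite HB, bigcupP. split; [| exact Na].
    exists (upair a a). rewrite HY, upairP. split; [exists 0 |]; auto.
  - apply HB in Hy. destruct Hy as [Hy Ny]. apply Ny. constructor. intros z Hz.
    apply NNPP. intro Nz. apply N. exists z. split; [| exact Hz].
    rewrite HB. split; [| exact Nz].
    apply bigcupP in Hy. destruct Hy as [u [Hu Hyu]].
    apply HY in Hu. destruct Hu as [k ->].
    rewrite bigcupP. exists (Nat.iter (S k) bigcup (upair a a)).
    rewrite HY. split; [eauto |]. simpl. rewrite bigcupP. eauto.
Qed.

Lemma in_dom_wf : well_founded in_dom.
Proof.
  apply (wf_incl _ _ (Relation_Operators.clos_trans V (fun x y => x ∈ y))).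
  - intros s t [r H].
    apply Relation_Operators.t_trans with (opair s r);
      [| apply Relation_Operators.t_step; exact H].
    apply Relation_Operators.t_trans with (upair s s);
      apply Relation_Operators.t_step;
      [| unfold opair]; apply upairP; tauto.
  - apply wf_clos_trans, mem_wf.
Qed.

(** ** Names *)

Definition val (G : V) : V -> V :=
  Fix in_dom_wf (fun _ => V) (fun t val_t =>
    setof (fun x => exists s (h : in_dom s t),
      (exists r, r ∈ G /\ opair s r ∈ t) /\ x = val_t s h)).

Definition check (one : V) : V -> V :=
  Fix mem_wf (fun _ => V) (fun x check_x =>
    setof (fun z => exists y (h : y ∈ x), z = opair (check_x y h) one)).

Definition gen_ext (M G : V) : V :=
  setof (fun x => exists t, t ∈ M /\ x = val G t).

Lemma image_ex (F : V -> V) a : exists c, forall x, x ∈ c <-> exists y, y ∈ a /\ x = F y.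
Proof.
  apply (zf_replacement V (fun y x => x = F y)). intros; congruence.
Qed.

Lemma gen_extP M G x : x ∈ gen_ext M G <-> exists t, t ∈ M /\ x = val G t.
Proof. apply (setofP (fun x => exists t, t ∈ M /\ x = val G t)), image_ex. Qed.

Lemma valP G t x :
  x ∈ val G t <-> exists s, (exists r, r ∈ G /\ opair s r ∈ t) /\ x = val G s.
Proof.
  unfold val at 1. rewrite Fix_eq.
  - fold (val G). rewrite setofP.
    + split.
      * intros [s [_ H]]. eauto.
      * intros [s [[r [Hr Hs]] E]]. exists s, (ex_intro _ r Hs). eauto.
    + destruct (image_ex (val G) (bigcup (bigcup t))) as [c Hc].
      destruct (separation (fun x => exists s,
        (exists r, r ∈ G /\ opair s r ∈ t) /\ x = val G s) c) as [d Hd].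
      exists d. intro z. rewrite Hd, Hc. split.
      * intros [_ [s [[r [Hr Hs]] E]]]. exists s, (ex_intro _ r Hs). eauto.
      * intros [s [_ [[r [Hr Hs]] E]]]. split; [| eauto].
        exists s. split; [| exact E].
        rewrite bigcupP. exists (upair s s). rewrite bigcupP, upairP.
        split; [| auto]. exists (opair s r). split; [exact Hs |].
        unfold opair. rewrite upairP. auto.
  - intros u f g E.
    replace g with f; [reflexivity |].
    extensionality s. extensionality h. apply E.
Qed.

Lemma checkP one x z :
  z ∈ check one x <-> exists y, y ∈ x /\ z = opair (check one y) one.
Proof.
  unfold check at 1. rewrite Fix_eq.
  - fold (check one). rewrite setofP.
    + split; [intros [y [h E]] | intros [y [h E]]]; eauto.
    + destruct (image_ex (fun y => opair (check one y) one) x) as [c Hc].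
      exists c. intro w. rewrite Hc.
      split; [intros [y [h E]] | intros [y [h E]]]; eauto.
  - intros u f g E.
    replace g with f; [reflexivity |].
    extensionality s. extensionality h. apply E.
Qed.

(** ** Forcing notions *)

Definition forcing_notion (P leq one : V) : Prop :=
  (forall z, z ∈ leq -> exists p q, p ∈ P /\ q ∈ P /\ z = opair p q) /\
  (forall p, p ∈ P -> opair p p ∈ leq) /\
  (forall p q r, opair p q ∈ leq -> opair q r ∈ leq -> opair p r ∈ leq) /\
  one ∈ P /\
  (forall p, p ∈ P -> opair p one ∈ leq).

Definition filter (P leq G : V) : Prop :=
  (forall p, p ∈ G -> p ∈ P) /\
  (exists p, p ∈ G) /\
  (forall p q, p ∈ G -> q ∈ P -> opair p q ∈ leq -> q ∈ G) /\
  (forall p q, p ∈ G -> q ∈ G ->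
     exists r, r ∈ G /\ opair r p ∈ leq /\ opair r q ∈ leq).

Definition dense (P leq D : V) : Prop :=
  (forall d, d ∈ D -> d ∈ P) /\
  (forall p, p ∈ P -> exists d, d ∈ D /\ opair d p ∈ leq).

Definition dense_below (P leq p : V) (D : V -> Prop) : Prop :=
  forall q, q ∈ P -> opair q p ∈ leq -> exists d, D d /\ opair d q ∈ leq.

Definition generic_filter (M P leq G : V) : Prop :=
  filter P leq G /\
  (forall D, D ∈ M -> dense P leq D -> exists p, p ∈ G /\ p ∈ D).

End Sets.

(** * Formulas *)

Inductive formula : Type :=
| fMem (i j : nat)
| fEq (i j : nat)
| fNand (φ ψ : formula)
| fAll (φ : formula).

Fixpoint arity (φ : formula) : nat :=
  match φ with
  | fMem i j | fEq i j => Nat.max (S i) (S j)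
  | fNand φ ψ => Nat.max (arity φ) (arity ψ)
  | fAll φ => Nat.pred (arity φ)
  end.

Fixpoint sat {V : ZF} (M : V) (env : list V) (φ : formula) : Prop :=
  match φ with
  | fMem i j => nth i env empty ∈ nth j env empty
  | fEq i j => nth i env empty = nth j env empty
  | fNand φ ψ => ~ (sat M env φ /\ sat M env ψ)
  | fAll φ => forall a, a ∈ M -> sat M (a :: env) φ
  end.

Definition fNot φ := fNand φ φ.
Definition fAnd φ ψ := fNot (fNand φ ψ).
Definition fOr φ ψ := fNand (fNot φ) (fNot ψ).
Definition fImp φ ψ := fNand φ (fNot ψ).
Definition fIff φ ψ := fAnd (fImp φ ψ) (fImp ψ φ).
Definition fEx φ := fNot (fAll (fNot φ)).

Definition lift (f : nat -> nat) (n : nat) : nat :=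
  match n with 0 => 0 | S k => S (f k) end.

Fixpoint ren (f : nat -> nat) (φ : formula) : formula :=
  match φ with
  | fMem i j => fMem (f i) (f j)
  | fEq i j => fEq (f i) (f j)
  | fNand φ ψ => fNand (ren f φ) (ren f ψ)
  | fAll φ => fAll (ren (lift f) φ)
  end.

(** ** Axioms

    The comments [x0 y1] record which index denotes which variable. *)

Definition Extensionality : formula :=
  fAll (fAll (* y0 x1 *)
    (fImp (fAll (fIff (fMem 0 2) (fMem 0 1))) (fEq 1 0))).

Definition Foundation : formula :=
  fAll (* x0 *) (fImp (fEx (fMem 0 1))
    (fEx (* y0 x1 *) (fAnd (fMem 0 1)
      (fNot (fEx (* z0 y1 x2 *) (fAnd (fMem 0 2) (fMem 0 1))))))).

Definition Pairing : formula :=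
  fAll (fAll (fEx (fAll (* x0 c1 b2 a3 *)
    (fIff (fMem 0 1) (fOr (fEq 0 3) (fEq 0 2)))))).

Definition Union : formula :=
  fAll (fEx (fAll (* x0 u1 a2 *)
    (fIff (fMem 0 1) (fEx (* y0 x1 u2 a3 *) (fAnd (fMem 0 3) (fMem 1 0)))))).

Definition Infinity : formula :=
  fEx (* I0 *) (fAnd
    (fEx (* e0 I1 *) (fAnd (fMem 0 1) (fAll (fNot (fMem 0 1)))))
    (fAll (* x0 I1 *) (fImp (fMem 0 1)
      (fEx (* s0 x1 I2 *) (fAnd (fMem 0 2)
        (fAll (* z0 s1 x2 *)
          (fIff (fMem 0 1) (fOr (fMem 0 2) (fEq 0 2))))))))).

Definition Powerset : formula :=
  fAll (fEx (fAll (* x0 p1 a2 *)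
    (fIff (fMem 0 1) (fAll (* z0 x1 p2 a3 *) (fImp (fMem 0 1) (fMem 0 3)))))).

(** In [φ(x, z)], index 0 is x and the indices from 1 on are the parameters. *)
Definition Separation (φ : formula) : formula :=
  Nat.iter (arity φ - 1) fAll
    (fAll (fEx (fAll (* x0 B1 A2 *)
      (fIff (fMem 0 1)
         (fAnd (fMem 0 2)
            (ren (fun n => match n with 0 => 0 | S i => i + 3 end) φ)))))).

(** In [φ(x, y, z)], index 0 is x, index 1 is y, and the indices from 2 on are
    the parameters. *)
Definition Replacement (φ : formula) : formula :=
  let at_xy x y :=
    ren (fun n => match n with 0 => x | 1 => y | S (S i) => i + 4 end) φ in
  Nat.iter (arity φ - 2) fAll
    (fAll (* A0 *) (fImp
      (fAll (* x0 A1 *) (fImp (fMem 0 1)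
        (fAll (fAll (* y'0 y1 x2 A3 *)
          (fImp (fAnd (at_xy 2 1) (at_xy 2 0)) (fEq 1 0))))))
      (fEx (fAll (* b0 Y1 A2 *)
        (fIff (fMem 0 1)
          (fEx (* x0 b1 Y2 A3 *) (fAnd (fMem 0 3) (at_xy 0 1)))))))).

Inductive Zermelo : formula -> Prop :=
| Z_extensionality : Zermelo Extensionality
| Z_foundation : Zermelo Foundation
| Z_pairing : Zermelo Pairing
| Z_union : Zermelo Union
| Z_infinity : Zermelo Infinity
| Z_powerset : Zermelo Powerset
| Z_separation φ : Zermelo (Separation φ).

Definition Z_plus_Replacement (Θ : list formula) (σ : formula) : Prop :=
  Zermelo σ \/ exists χ, In χ Θ /\ σ = Replacement χ.

Definition models {V : ZF} (M : V) (T : formula -> Prop) : Prop :=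
  forall σ, T σ -> sat M [] σ.

Section SatFacts.
Context {V : ZF} (M : V).

Lemma sat_not env φ : sat M env (fNot φ) <-> ~ sat M env φ.
Proof. simpl. tauto. Qed.

Lemma sat_and env φ ψ : sat M env (fAnd φ ψ) <-> sat M env φ /\ sat M env ψ.
Proof. simpl. tauto. Qed.

Lemma sat_or env φ ψ : sat M env (fOr φ ψ) <-> sat M env φ \/ sat M env ψ.
Proof. simpl. tauto. Qed.

Lemma sat_imp env φ ψ : sat M env (fImp φ ψ) <-> (sat M env φ -> sat M env ψ).
Proof. simpl. tauto. Qed.

Lemma sat_iff env φ ψ : sat M env (fIff φ ψ) <-> (sat M env φ <-> sat M env ψ).
Proof. unfold fIff. rewrite sat_and, !sat_imp. tauto. Qed.

Lemma sat_ex env φ :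
  sat M env (fEx φ) <-> exists a, a ∈ M /\ sat M (a :: env) φ.
Proof.
  unfold fEx. rewrite sat_not. simpl. split.
  - intro H. apply NNPP. intro N. apply H. intros a Ha [H1 _]. eauto.
  - intros [a [Ha H]] N. apply (N a Ha). auto.
Qed.

Lemma sat_ren φ : forall f env env',
  (forall n, n < arity φ -> nth (f n) env empty = nth n env' empty) ->
  sat M env (ren f φ) <-> sat M env' φ.
Proof.
  induction φ as [i j | i j | φ IHφ ψ IHψ | φ IHφ]; simpl; intros f env env' H.
  - rewrite !H by lia. tauto.
  - rewrite !H by lia. tauto.
  - rewrite (IHφ f env env'), (IHψ f env env'); [tauto | |];
      intros n Hn; apply H; lia.
  - assert (E : forall a, sat M (a :: env) (ren (lift f) φ) <-> sat M (a :: env') φ).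
    { intro a. apply IHφ. intros [| n] Hn; simpl; [reflexivity |].
      apply H. lia. }
    split; intros K a Ha; apply E, K, Ha.
Qed.

Lemma sat_iter_all k φ : forall env,
  sat M env (Nat.iter k fAll φ) <->
  forall zs, length zs = k -> Forall (fun z => z ∈ M) zs -> sat M (zs ++ env) φ.
Proof.
  induction k as [| k IH]; intro env.
  - simpl. split.
    + intros H [| z zs] L _; [exact H | discriminate].
    + intro H. apply (H [] eq_refl). constructor.
  - simpl. split.
    + intros H zs L Fzs.
      destruct (exists_last (l := zs)) as [ys [y E]].
      { intro E. rewrite E in L. discriminate. }
      subst zs. rewrite length_app in L. simpl in L.
      apply Forall_app in Fzs. destruct Fzs as [Fys Fy].
      rewrite <- app_assoc. simpl. apply IH; [| lia | exact Fys].
      apply H. inversion Fy. assumption.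
    + intros H a Ha. apply IH. intros zs L Fzs.
      replace (zs ++ a :: env) with ((zs ++ [a]) ++ env)
        by (rewrite <- app_assoc; reflexivity).
      apply H.
      * rewrite length_app. simpl. lia.
      * apply Forall_app. auto.
Qed.

Lemma sat_Separation φ :
  sat M [] (Separation φ) <->
  forall zs, length zs = arity φ - 1 -> Forall (fun z => z ∈ M) zs ->
  forall A, A ∈ M -> exists B, B ∈ M /\
    forall x, x ∈ M -> (x ∈ B <-> x ∈ A /\ sat M (x :: zs) φ).
Proof.
  unfold Separation. rewrite sat_iter_all.
  assert (R : forall x B A zs,
    sat M (x :: B :: A :: zs)
      (ren (fun n => match n with 0 => 0 | S i => i + 3 end) φ) <->
    sat M (x :: zs) φ).
  { intros. apply sat_ren. intros [| n] _; [reflexivity |].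
    rewrite (Nat.add_comm n 3). reflexivity. }
  split; intros H zs L F.
  - intros A HA. specialize (H zs L F A HA). rewrite app_nil_r in H.
    apply sat_ex in H. destruct H as [B [HB H]]. exists B. split; [exact HB |].
    intros x Hx. specialize (H x Hx).
    rewrite sat_iff, sat_and, R in H. exact H.
  - rewrite app_nil_r. intros A HA. destruct (H zs L F A HA) as [B [HB K]].
    apply sat_ex. exists B. split; [exact HB |].
    intros x Hx. rewrite sat_iff, sat_and, R. exact (K x Hx).
Qed.

Lemma sat_Replacement φ :
  sat M [] (Replacement φ) <->
  forall zs, length zs = arity φ - 2 -> Forall (fun z => z ∈ M) zs ->
  forall A, A ∈ M ->
    (forall x, x ∈ M -> x ∈ A -> forall y, y ∈ M -> forall y', y' ∈ M ->
       sat M (x :: y :: zs) φ /\ sat M (x :: y' :: zs) φ -> y = y') ->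
    exists Y, Y ∈ M /\
      forall b, b ∈ M ->
        (b ∈ Y <-> exists x, x ∈ M /\ x ∈ A /\ sat M (x :: b :: zs) φ).
Proof.
  unfold Replacement. rewrite sat_iter_all.
  assert (R : forall x y v0 v1 v2 v3 zs,
    x < 4 -> y < 4 ->
    sat M (v0 :: v1 :: v2 :: v3 :: zs) (ren (fun n => match n with 0 => x | 1 => y | S (S i) => i + 4 end) φ) <->
    sat M (nth x [v0; v1; v2; v3] empty ::
           nth y [v0; v1; v2; v3] empty :: zs) φ).
  { intros x y v0 v1 v2 v3 zs Hx Hy. apply sat_ren. intros [| [| n]] _; simpl.
    - destruct x as [| [| [| [| x]]]]; try reflexivity; lia.
    - destruct y as [| [| [| [| y]]]]; try reflexivity; lia.
    - rewrite (Nat.add_comm n 4). reflexivity. }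
  split; intros H zs L F.
  - intros A HA U. specialize (H zs L F A HA). rewrite app_nil_r in H.
    rewrite sat_imp, sat_ex in H. destruct H as [Y [HY K]]; cycle 1.
    + exists Y. split; [exact HY |].
      intros b Hb. specialize (K b Hb). rewrite sat_iff, sat_ex in K.
      split.
      * intro Hb'. apply (proj1 K) in Hb'. destruct Hb' as [x [Hx Hx']].
        rewrite sat_and, R in Hx' by lia. eauto.
      * intros [x [Hx Hx']]. apply (proj2 K). exists x. split; [exact Hx |].
        rewrite sat_and, R by lia. exact Hx'.
    + intros x Hx. rewrite sat_imp. intros HxA y Hy y' Hy'.
      rewrite sat_imp, sat_and, !R by lia. exact (U x Hx HxA y Hy y' Hy').
  - rewrite app_nil_r. intros A HA. rewrite sat_imp. intro U.
    destruct (H zs L F A HA) as [Y [HY K]].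
    + intros x Hx HxA y Hy y' Hy'.
      specialize (U x Hx). rewrite sat_imp in U. specialize (U HxA y Hy y' Hy').
      rewrite sat_imp, sat_and, !R in U by lia. exact U.
    + apply sat_ex. exists Y. split; [exact HY |]. intros b Hb.
      rewrite sat_iff, sat_ex. specialize (K b Hb). split.
      * intro Hb'. apply (proj1 K) in Hb'. destruct Hb' as [x [Hx Hx']].
        exists x. split; [exact Hx |]. rewrite sat_and, R by lia. exact Hx'.
      * intros [x [Hx Hx']]. rewrite sat_and, R in Hx' by lia.
        apply (proj2 K). eauto.
Qed.

End SatFacts.

(** * The replacement instances *)

Section Recursions.
Context {V : ZF}.
Implicit Types M P leq one r f a b x y z t : V.

(** [f] restricted to the [r]-predecessors of [x]. *)
Definition restrict_pred r f x : V :=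
  setof (fun z => z ∈ f /\ exists u v, z = opair u v /\ opair u x ∈ r).

(** A recursion is given by the graph of its step: [H x g y] says that [y] is
    the value at [x], where [g] is the function computed so far, restricted to
    the [r]-predecessors of [x]. *)
Definition is_recfun r (H : V -> V -> V -> Prop) a f : Prop :=
  (forall z, z ∈ f -> exists x y, z = opair x y) /\
  (forall x, (exists y, opair x y ∈ f) <-> opair x a ∈ r) /\
  (forall x y y', opair x y ∈ f -> opair x y' ∈ f -> y = y') /\
  (forall x y, opair x y ∈ f -> H x (restrict_pred r f x) y).

(** [z] is the pair of [x] and the value at [x] of the recursion along [r] with
    step [H], as computed inside [M]. *)
Definition wfrec_in M r (H : V -> V -> V -> Prop) x z : Prop :=
  exists y f, y ∈ M /\ f ∈ M /\ z = opair x y /\ is_recfun r H x f /\ H x f y.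

Definition step_iter_union a n f y : Prop :=
  (n = empty /\ y = a) \/
  (exists m v, n = succ m /\ opair m v ∈ f /\ y = bigcup v).

Definition step_rank x f y : Prop :=
  forall w, w ∈ y <->
    exists u v, u ∈ x /\ opair u v ∈ f /\ (w ∈ v \/ w = v).

Definition step_cumulative M x f y : Prop :=
  forall w, w ∈ y <-> w ∈ M /\
    exists u v, u ∈ x /\ opair u v ∈ f /\ (forall s, s ∈ w -> s ∈ v).

Definition step_check one x f y : Prop :=
  forall w, w ∈ y <-> exists u v, u ∈ x /\ opair u v ∈ f /\ w = opair v one.

(** The arguments of the forcing recursion are quadruples <k, t1, t2, p>, with
    k = 0 for "p forces t1 = t2" and k = 1 for "p forces t1 in t2"; the values
    are the truth values 0 and 1. *)
Definition at_query (k : nat) t1 t2 p : V :=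
  opair (numeral k) (opair t1 (opair t2 p)).

Definition step_atomic_forcing P leq t f b : Prop :=
  let holds k t1 t2 q := opair (at_query k t1 t2 q) (numeral 1) ∈ f in
  let forced :=
    exists t1 t2 p, p ∈ P /\
      ((t = at_query 0 t1 t2 p /\
        forall s q, in_dom s t1 \/ in_dom s t2 -> q ∈ P -> opair q p ∈ leq ->
          (holds 1 s t1 q <-> holds 1 s t2 q)) \/
       (t = at_query 1 t1 t2 p /\
        dense_below P leq p (fun q => q ∈ P /\ opair q p ∈ leq /\
          exists s r, opair s r ∈ t2 /\ opair q r ∈ leq /\ holds 0 t1 s q))) in
  (b = numeral 1 /\ forced) \/ (b = numeral 0 /\ ~ forced).

End Recursions.

(** In each kind, the hypothesis that [M] is a transitive model of Zermelo set
    theory makes the notions involved absolute; the well-founded recursions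
    have their relation [r] as a parameter. *)
Definition transitive_model {V : ZF} (M : V) (Θ : list formula) : Prop :=
  transitive_set M /\ models M (Z_plus_Replacement Θ).

Definition union_iterates_kind (χ : formula) : Prop :=
  arity χ <= 3 /\
  forall (V : ZF) (M : V), transitive_model M [] ->
  forall n y a, n ∈ M -> y ∈ M -> a ∈ M ->
    (sat M [n; y; a] χ <->
     exists k, n = numeral k /\ y = Nat.iter k bigcup a).

Definition union_recursion_kind (χ : formula) : Prop :=
  arity χ <= 4 /\
  forall (V : ZF) (M : V), transitive_model M [] ->
  forall x z r a, x ∈ M -> z ∈ M -> r ∈ M -> a ∈ M ->
    (sat M [x; z; r; a] χ <-> wfrec_in M r (step_iter_union a) x z).

Definition rank_kind (χ : formula) : Prop :=
  arity χ <= 3 /\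
  forall (V : ZF) (M : V), transitive_model M [] ->
  forall x z r, x ∈ M -> z ∈ M -> r ∈ M ->
    (sat M [x; z; r] χ <-> wfrec_in M r step_rank x z).

Definition cumulative_kind (χ : formula) : Prop :=
  arity χ <= 3 /\
  forall (V : ZF) (M : V), transitive_model M [] ->
  forall x z r, x ∈ M -> z ∈ M -> r ∈ M ->
    (sat M [x; z; r] χ <-> wfrec_in M r (step_cumulative M) x z).

Definition check_recursion_kind (χ : formula) : Prop :=
  arity χ <= 4 /\
  forall (V : ZF) (M : V), transitive_model M [] ->
  forall x z r one, x ∈ M -> z ∈ M -> r ∈ M -> one ∈ M ->
    (sat M [x; z; r; one] χ <-> wfrec_in M r (step_check one) x z).

Definition atomic_forcing_kind (χ : formula) : Prop :=
  arity χ <= 5 /\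
  forall (V : ZF) (M : V), transitive_model M [] ->
  forall x z r P leq, x ∈ M -> z ∈ M -> r ∈ M -> P ∈ M -> leq ∈ M ->
    (sat M [x; z; r; P; leq] χ <->
     wfrec_in M r (step_atomic_forcing P leq) x z).

(** Check-names need not exist in a model of Zermelo set theory; the instances
    [Θ] provide them. *)
Definition check_graph_kind (Θ : list formula) (χ : formula) : Prop :=
  arity χ <= 3 /\
  forall (V : ZF) (M : V), transitive_model M Θ ->
  forall x z one, x ∈ M -> z ∈ M -> one ∈ M ->
    (sat M [x; z; one] χ <-> z = opair x (check one x)).

Definition seven_kinds (Θ : list formula) : Prop :=
  exists χ1 χ2 χ3 χ4 χ5 χ6 χ7,
    Θ = [χ1; χ2; χ3; χ4; χ5; χ6; χ7] /\ NoDup Θ /\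
    union_iterates_kind χ1 /\
    union_recursion_kind χ2 /\
    rank_kind χ3 /\
    cumulative_kind χ4 /\
    check_recursion_kind χ5 /\
    atomic_forcing_kind χ6 /\
    check_graph_kind [χ1; χ2; χ3; χ4; χ5; χ6] χ7.

(** * The forcing translation *)

Definition fUpair (z a b : nat) : formula :=
  fAll (fIff (fMem 0 (S z)) (fOr (fEq 0 (S a)) (fEq 0 (S b)))).

Definition fOpair (z a b : nat) : formula :=
  fAll (fIff (fMem 0 (S z))
    (fOr (fUpair 0 (S a) (S a)) (fUpair 0 (S a) (S b)))).

Definition fLeq (q p leq : nat) : formula :=
  fEx (fAnd (fMem 0 (S leq)) (fOpair 0 (S q) (S p))).

(** The translation is evaluated in [p; P; leq; one; t_0; t_1; ...], and the
    formulas [feq] and [fmem] for the atomic cases in [p; P; leq; one; t1; t2].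
    In the case of [fNand] the new condition q is put in front, so that p, P and
    leq have indices 1, 2, 3, and p is skipped when forcing the two conjuncts.
    In the case of [fAll] the bound name, bound at index 0, is moved to position
    4. *)
Fixpoint forces_rec (feq fmem : formula) (φ : formula) : formula :=
  let names i j := fun n => match n with 4 => 4 + i | 5 => 4 + j | _ => n end in
  match φ with
  | fEq i j => ren (names i j) feq
  | fMem i j => ren (names i j) fmem
  | fNand φ ψ =>
      let skip := fun n => match n with 0 => 0 | S k => S (S k) end in
      fNot (fEx (fAnd (fMem 0 2) (fAnd (fLeq 0 1 3)
        (fAnd (ren skip (forces_rec feq fmem φ))
              (ren skip (forces_rec feq fmem ψ))))))
  | fAll φ =>
      fAll (ren (fun n => if n <? 4 then S n else if n =? 4 then 0 else n)
        (forces_rec feq fmem φ))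
  end.

(** [F p φ ts] satisfies the defining clauses of "p forces φ[ts]"; these
    determine it, by recursion on names and formulas. *)
Definition is_forcing_relation {V : ZF} (M P leq : V)
    (F : V -> formula -> list V -> Prop) : Prop :=
  forall p ts, p ∈ P -> Forall (fun t => t ∈ M) ts ->
  (forall i j, i < length ts -> j < length ts ->
     let t1 := nth i ts empty in let t2 := nth j ts empty in
     F p (fEq i j) ts <->
     forall s q, in_dom s t1 \/ in_dom s t2 -> q ∈ P -> opair q p ∈ leq ->
       (F q (fMem 0 1) [s; t1] <-> F q (fMem 0 1) [s; t2])) /\
  (forall i j, i < length ts -> j < length ts ->
     let t1 := nth i ts empty in let t2 := nth j ts empty in
     F p (fMem i j) ts <->
     dense_below P leq p (fun q => q ∈ P /\ opair q p ∈ leq /\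
       exists s r, opair s r ∈ t2 /\ opair q r ∈ leq /\
         F q (fEq 0 1) [t1; s])) /\
  (forall φ ψ, arity (fNand φ ψ) <= length ts ->
     F p (fNand φ ψ) ts <->
     ~ exists q, q ∈ P /\ opair q p ∈ leq /\ F q φ ts /\ F q ψ ts) /\
  (forall φ, arity (fAll φ) <= length ts ->
     F p (fAll φ) ts <-> forall t, t ∈ M -> F p φ (t :: ts)).

(* Main.v *)
(** Forcing of an equality [a = b] is the greatest fixed point of the monotone
    clause "for [<s, r>] in [a], every [q] below [p] and [r] forces [s] in [b],
    and conversely".  Hence it is definable in [M] as membership in some
    post-fixed set [W] of [M], without recursion; transitive closures, which
    exist in [M] by the first replacement instance, make it a fixed point.  Both
    directions of the truth lemma for equalities are then inductions on the
    first name, and the formulas are treated as usual.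

    Check-names are defined in [M] by the same device.  The formulas themselves
    are never written down: they are unification variables [?φ] of goals
    [sat M env ?φ <-> Q], instantiated by a proof directed by [Q]. *)

Require Import Defs.
From Stdlib Require Import List Arith Lia Classical.
Import ListNotations.

(** * Zermelo models and definability *)

(** A recursion on names would require its partial solutions to be collected and glued into sets of
    $M$, where only a few replacement instances hold. Post-fixed sets avoid this: they need not be
    functional, be total or agree with each other. The relation that they witness together is given
    by one formula, so Separation cuts it out of a product over a transitive set, and that single
    set is again post-fixed.

    The price is a change of clause. The equivalence between forcing $\sigma\in\tau_1$ and forcing
    $\sigma\in\tau_2$ is not monotone in forced equality, so it has no evident greatest fixed point.
    The two inclusions are monotone. The equivalence is recovered from them only after forced
    equality is known to be reflexive, symmetric and transitive.

    Definability is used the same way for genericity: each set of conditions that decides a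
    statement is given by a formula, hence belongs to $M$ and must meet $G$. *)

Lemma sat_ext {V : ZF} (M : V) φ env env' :
  (forall n, n < arity φ -> nth n env empty = nth n env' empty) ->
  sat M env φ <-> sat M env' φ.
Proof.
  intro H. rewrite <- (sat_ren M φ (fun n => n) env env' H).
  rewrite (sat_ren M φ (fun n => n) env env); reflexivity.
Qed.

Lemma arity_ren φ : forall f m,
  (forall n, n < arity φ -> f n < m) -> arity (ren f φ) <= m.
Proof.
  induction φ as [i j | i j | φ IHφ ψ IHψ | φ IHφ]; simpl; intros f m H.
  - generalize (H i) (H j). lia.
  - generalize (H i) (H j). lia.
  - apply Nat.max_lub; [apply IHφ | apply IHψ]; intros; apply H; lia.
  - apply Nat.pred_le_mono with (m := S m), IHφ.
    intros [| n] Hn; simpl; [lia |]. apply -> Nat.succ_lt_mono. apply H. lia.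
Qed.

Lemma nth_map_seq {A} (f : nat -> A) (d : A) k n :
  n < k -> nth n (map f (seq 0 k)) d = f n.
Proof.
  intro Hn. rewrite nth_indep with (d' := f k)
    by (rewrite length_map, length_seq; exact Hn).
  rewrite map_nth, seq_nth by exact Hn. reflexivity.
Qed.

Lemma arity_mem i j k : i < k -> j < k -> arity (fMem i j) <= k.
Proof. simpl. lia. Qed.

Lemma arity_eq i j k : i < k -> j < k -> arity (fEq i j) <= k.
Proof. simpl. lia. Qed.

Lemma arity_not φ k : arity φ <= k -> arity (fNot φ) <= k.
Proof. simpl. lia. Qed.

Lemma arity_and φ ψ k : arity φ <= k -> arity ψ <= k -> arity (fAnd φ ψ) <= k.
Proof. simpl. lia. Qed.

Lemma arity_or φ ψ k : arity φ <= k -> arity ψ <= k -> arity (fOr φ ψ) <= k.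
Proof. simpl. lia. Qed.

Lemma arity_imp φ ψ k : arity φ <= k -> arity ψ <= k -> arity (fImp φ ψ) <= k.
Proof. simpl. lia. Qed.

Lemma arity_iff φ ψ k : arity φ <= k -> arity ψ <= k -> arity (fIff φ ψ) <= k.
Proof. simpl. lia. Qed.

Lemma arity_all φ k : arity φ <= S k -> arity (fAll φ) <= k.
Proof. simpl. lia. Qed.

Lemma arity_ex φ k : arity φ <= S k -> arity (fEx φ) <= k.
Proof. simpl. lia. Qed.

Lemma arity_opair h i j k : h < k -> i < k -> j < k -> arity (fOpair h i j) <= k.
Proof.
  intros. unfold fOpair, fUpair.
  repeat first [apply arity_all | apply arity_iff | apply arity_or
    | apply arity_mem | apply arity_eq]; lia.
Qed.

(* [fNot] duplicates its argument, so arities are not to be computed. *)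
Ltac bound_arity :=
  repeat lazymatch goal with
  | |- arity (fMem _ _) <= _ => apply arity_mem
  | |- arity (fEq _ _) <= _ => apply arity_eq
  | |- arity (fNot _) <= _ => apply arity_not
  | |- arity (fAnd _ _) <= _ => apply arity_and
  | |- arity (fOr _ _) <= _ => apply arity_or
  | |- arity (fImp _ _) <= _ => apply arity_imp
  | |- arity (fIff _ _) <= _ => apply arity_iff
  | |- arity (fAll _) <= _ => apply arity_all
  | |- arity (fEx _) <= _ => apply arity_ex
  | |- arity (fOpair _ _ _) <= _ => apply arity_opair
  | |- _ < _ => lia
  end.

(** * Closure of a transitive Zermelo model under basic operations *)

Section Model.
Context {V : ZF} (M : V) (HM : transitive_model M []).

Lemma M_trans x y : x ∈ y -> y ∈ M -> x ∈ M.
Proof. intros Hx Hy. exact (proj1 HM y x Hy Hx). Qed.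

Lemma M_axiom σ : Zermelo σ -> sat M [] σ.
Proof. intro H. apply (proj2 HM). left. exact H. Qed.

Lemma upair_M a b : a ∈ M -> b ∈ M -> upair a b ∈ M.
Proof.
  intros Ha Hb.
  pose proof (M_axiom _ Z_pairing a Ha b Hb) as H.
  apply sat_ex in H. destruct H as [c [Hc H]].
  replace (upair a b) with c; [exact Hc |].
  apply zf_extensionality. intro x. rewrite upairP. split.
  - intro Hx. specialize (H x (M_trans _ _ Hx Hc)).
    rewrite sat_iff, sat_or in H. apply H, Hx.
  - intro Hx. assert (x ∈ M) by (destruct Hx; subst; assumption).
    specialize (H x ltac:(assumption)).
    rewrite sat_iff, sat_or in H. apply H, Hx.
Qed.

Lemma bigcup_M a : a ∈ M -> bigcup a ∈ M.
Proof.
  intro Ha. pose proof (M_axiom _ Z_union a Ha) as H.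
  apply sat_ex in H. destruct H as [c [Hc H]].
  replace (bigcup a) with c; [exact Hc |].
  apply zf_extensionality. intro x. rewrite bigcupP. split.
  - intro Hx. specialize (H x (M_trans _ _ Hx Hc)).
    rewrite sat_iff, sat_ex in H. apply H in Hx. destruct Hx as [y [Hy Hx]].
    apply sat_and in Hx. exists y. exact Hx.
  - intros [y [Hy Hx]]. pose proof (M_trans _ _ Hy Ha) as HyM.
    specialize (H x (M_trans _ _ Hx HyM)). rewrite sat_iff, sat_ex in H.
    apply H. exists y. rewrite sat_and. simpl. auto.
Qed.

Lemma powerset_M a :
  a ∈ M -> exists p, p ∈ M /\
    forall x, x ∈ M -> (forall z, z ∈ x -> z ∈ a) -> x ∈ p.
Proof.
  intro Ha. pose proof (M_axiom _ Z_powerset a Ha) as H.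
  apply sat_ex in H. destruct H as [p [Hp H]]. exists p. split; [exact Hp |].
  intros x Hx Hsub. specialize (H x Hx). rewrite sat_iff in H. apply H.
  intros z Hz. rewrite sat_imp. exact (Hsub z).
Qed.

(** A superset of $\omega$ suffices: the relations applied to [I] later mention numerals explicitly
    and so discard its other elements. *)
Lemma infinity_M :
  exists I, I ∈ M /\ forall k, numeral k ∈ I.
Proof.
  pose proof (M_axiom _ Z_infinity) as H.
  apply sat_ex in H. destruct H as [I [HI H]]. apply sat_and in H.
  destruct H as [He Hs]. exists I. split; [exact HI |].
  induction k as [| k IH]; simpl.
  - apply sat_ex in He. destruct He as [e [HeM He]]. apply sat_and in He.
    destruct He as [HeI He]. replace empty with e; [exact HeI |].
    apply zf_extensionality. intro z. split.
    + intro Hz. specialize (He z (M_trans _ _ Hz HeM)). apply sat_not in He.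
      destruct (He Hz).
    + intro Hz. destruct (emptyP z Hz).
  - specialize (Hs _ (M_trans _ _ IH HI)). rewrite sat_imp, sat_ex in Hs.
    destruct (Hs IH) as [s [HsM K]]. apply sat_and in K. destruct K as [HsI K].
    replace (succ (numeral k)) with s; [exact HsI |].
    apply zf_extensionality. intro z. rewrite succP. split.
    + intro Hz. specialize (K z (M_trans _ _ Hz HsM)).
      rewrite sat_iff, sat_or in K. apply K, Hz.
    + intro Hz. assert (HzM : z ∈ M).
      { destruct Hz as [Hz | ->]; [apply (M_trans _ _ Hz) |];
          exact (M_trans _ _ IH HI). }
      specialize (K z HzM). rewrite sat_iff, sat_or in K. apply K, Hz.
Qed.

Lemma numeral_M k : numeral k ∈ M.
Proof. destruct infinity_M as [I [HI H]]. exact (M_trans _ _ (H k) HI). Qed.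

Lemma empty_M : empty ∈ M.
Proof. exact (numeral_M 0). Qed.

Lemma opair_M a b : a ∈ M -> b ∈ M -> opair a b ∈ M.
Proof. intros. unfold opair. auto using upair_M. Qed.

Lemma opair_M_l a b : opair a b ∈ M -> a ∈ M.
Proof.
  intro H. apply (M_trans a (upair a a)); [apply upairP; auto |].
  apply (M_trans _ (opair a b)); [apply upairP; auto | exact H].
Qed.

Lemma opair_M_r a b : opair a b ∈ M -> b ∈ M.
Proof.
  intro H. apply (M_trans b (upair a b)); [apply upairP; auto |].
  apply (M_trans _ (opair a b)); [apply upairP; auto | exact H].
Qed.

Lemma union2 a b :
  exists c, (a ∈ M -> b ∈ M -> c ∈ M) /\ forall x, x ∈ c <-> x ∈ a \/ x ∈ b.
Proof.
  exists (bigcup (upair a b)). split; [auto using bigcup_M, upair_M |].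
  intro x. rewrite bigcupP. split.
  - intros [y [Hy Hx]]. apply upairP in Hy. destruct Hy; subst; auto.
  - intros [H | H]; [exists a | exists b]; rewrite upairP; auto.
Qed.

Lemma succ_M a : a ∈ M -> succ a ∈ M.
Proof.
  intro Ha. destruct (union2 a (upair a a)) as [c [Hc K]].
  replace (succ a) with c; [auto using upair_M |].
  apply zf_extensionality. intro x. rewrite K, succP, upairP. tauto.
Qed.

Lemma succ_M_inv a : succ a ∈ M -> a ∈ M.
Proof. apply M_trans, succP. auto. Qed.

Lemma nth_M i zs : Forall (fun z => z ∈ M) zs -> nth i zs empty ∈ M.
Proof.
  intro H. destruct (Nat.lt_ge_cases i (length zs)) as [L | L].
  - apply (proj1 (Forall_forall _ _) H), nth_In, L.
  - rewrite nth_overflow by exact L. exact empty_M.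
Qed.

(** The axiom takes exactly [arity φ - 1] parameters. The list [zs] is therefore truncated, or
    padded with [empty], which lies in [M] and is also the default that [sat] reads beyond the end
    of an environment. *)
Lemma separation_M φ zs A (Q : V -> Prop) :
  A ∈ M -> Forall (fun z => z ∈ M) zs ->
  (forall x, x ∈ M -> (sat M (x :: zs) φ <-> Q x)) ->
  exists B, B ∈ M /\ forall x, x ∈ B <-> x ∈ A /\ Q x.
Proof.
  intros HA Hzs HQ.
  destruct (proj1 (sat_Separation M φ) (M_axiom _ (Z_separation φ))
    (map (fun i => nth i zs empty) (seq 0 (arity φ - 1)))) with (A := A)
    as [B [HB K]].
  - rewrite length_map, length_seq. reflexivity.
  - apply Forall_map, Forall_forall. intros i _. exact (nth_M i zs Hzs).
  - exact HA.
  - exists B. split; [exact HB |]. intro x.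
    assert (E : x ∈ M -> (x ∈ B <-> x ∈ A /\ Q x)).
    { intro Hx. rewrite (K x Hx), <- (HQ x Hx).
      rewrite (sat_ext M φ (x :: zs)); [reflexivity |].
      intros [| n] Hn; simpl; [reflexivity |].
      symmetry. apply (nth_map_seq (fun i => nth i zs empty)). lia. }
    split; intro H; apply E; auto.
    + exact (M_trans _ _ H HB).
    + destruct H as [H _]. exact (M_trans _ _ H HA).
Qed.

Lemma sat_upair env i j k :
  nth i env empty ∈ M -> nth j env empty ∈ M -> nth k env empty ∈ M ->
  sat M env (fUpair i j k) <->
  nth i env empty = upair (nth j env empty) (nth k env empty).
Proof.
  intros Hi Hj Hk. split.
  - intro H. apply zf_extensionality. intro x.
    rewrite upairP. split.
    + intro Hx. specialize (H x (M_trans _ _ Hx Hi)).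
      rewrite sat_iff, sat_or in H. apply H, Hx.
    + intro Hx. assert (HxM : x ∈ M) by (destruct Hx; subst; assumption).
      specialize (H x HxM).
      rewrite sat_iff, sat_or in H. apply H, Hx.
  - intros H x Hx. rewrite sat_iff, sat_or. simpl. rewrite H. apply upairP.
Qed.

Lemma sat_opair env i j k :
  nth i env empty ∈ M -> nth j env empty ∈ M -> nth k env empty ∈ M ->
  sat M env (fOpair i j k) <->
  nth i env empty = opair (nth j env empty) (nth k env empty).
Proof.
  intros Hi Hj Hk.
  assert (E : forall x, x ∈ M ->
    (sat M (x :: env) (fOr (fUpair 0 (S j) (S j)) (fUpair 0 (S j) (S k))) <->
     x ∈ opair (nth j env empty) (nth k env empty))).
  { intros x Hx. rewrite sat_or, !sat_upair by assumption. simpl.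
    symmetry. apply upairP. }
  split.
  - intro H. apply zf_extensionality. intro x. split.
    + intro Hx. pose proof (M_trans _ _ Hx Hi) as HxM. specialize (H x HxM).
      rewrite sat_iff, E in H by exact HxM. apply H, Hx.
    + intro Hx. assert (HxM : x ∈ M)
        by (apply (M_trans _ _ Hx); auto using opair_M).
      specialize (H x HxM). rewrite sat_iff, E in H by exact HxM. apply H, Hx.
  - intros H x Hx. rewrite sat_iff, E by exact Hx. simpl. rewrite H. reflexivity.
Qed.

Lemma sat_leq env i j k :
  nth i env empty ∈ M -> nth j env empty ∈ M -> nth k env empty ∈ M ->
  sat M env (fLeq i j k) <->
  opair (nth i env empty) (nth j env empty) ∈ nth k env empty.
Proof.
  intros Hi Hj Hk. unfold fLeq. rewrite sat_ex. split.
  - intros [a [Ha H]]. rewrite sat_and, sat_opair in H by assumption.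
    simpl in H. destruct H as [H ->]. exact H.
  - intro H. exists (opair (nth i env empty) (nth j env empty)).
    split; [auto using opair_M |].
    rewrite sat_and, sat_opair by (simpl; auto using opair_M). auto.
Qed.

(** * Definability by reification *)

(** Bounded quantifiers ranging over [V] need not mention [M]: the first
    premise of [reify_ex] and [reify_all] restricts them. *)

Lemma reify_mem env i j x y :
  nth i env empty = x -> nth j env empty = y ->
  sat M env (fMem i j) <-> x ∈ y.
Proof. intros <- <-. reflexivity. Qed.

(** Serves conjuncts [x ∈ M]: [M] has no index, but every variable of the environment is already
    known to belong to it. *)
Lemma reify_true env i A : A -> sat M env (fEq i i) <-> A.
Proof. simpl. tauto. Qed.

Lemma reify_eq env i j x y :
  nth i env empty = x -> nth j env empty = y ->
  sat M env (fEq i j) <-> x = y.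
Proof. intros <- <-. reflexivity. Qed.

Lemma reify_opair env i j k x a b :
  nth i env empty = x -> nth j env empty = a -> nth k env empty = b ->
  x ∈ M -> a ∈ M -> b ∈ M ->
  sat M env (fOpair i j k) <-> x = opair a b.
Proof. intros <- <- <-. apply sat_opair. Qed.

Lemma reify_not env φ A :
  sat M env φ <-> A -> sat M env (fNot φ) <-> ~ A.
Proof. rewrite sat_not. tauto. Qed.

Lemma reify_and env φ ψ A B :
  sat M env φ <-> A -> sat M env ψ <-> B -> sat M env (fAnd φ ψ) <-> A /\ B.
Proof. rewrite sat_and. tauto. Qed.

Lemma reify_or env φ ψ A B :
  sat M env φ <-> A -> sat M env ψ <-> B -> sat M env (fOr φ ψ) <-> A \/ B.
Proof. rewrite sat_or. tauto. Qed.

Lemma reify_imp env φ ψ A B :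
  sat M env φ <-> A -> sat M env ψ <-> B -> sat M env (fImp φ ψ) <-> (A -> B).
Proof. rewrite sat_imp. tauto. Qed.

Lemma reify_iff env φ ψ A B :
  sat M env φ <-> A -> sat M env ψ <-> B ->
  sat M env (fIff φ ψ) <-> (A <-> B).
Proof. rewrite sat_iff. tauto. Qed.

Lemma reify_ex env φ (Q : V -> Prop) :
  (forall a, Q a -> a ∈ M) ->
  (forall a, a ∈ M -> sat M (a :: env) φ <-> Q a) ->
  sat M env (fEx φ) <-> exists a, Q a.
Proof.
  intros B H. rewrite sat_ex. split.
  - intros [a [Ha K]]. exists a. apply H; assumption.
  - intros [a K]. exists a. split; [| apply H]; auto.
Qed.

Lemma reify_all env φ (Q : V -> Prop) :
  (forall a, ~ a ∈ M -> Q a) ->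
  (forall a, a ∈ M -> sat M (a :: env) φ <-> Q a) ->
  sat M env (fAll φ) <-> forall a, Q a.
Proof.
  intros B H. simpl. split.
  - intros K a. destruct (classic (a ∈ M)) as [Ha | Ha]; [| auto].
    apply H; auto.
  - intros K a Ha. apply H; auto.
Qed.

(** The language has no function symbols, so a compound term is replaced by a new variable together
    with a formula defining it. *)
Lemma reify_let env φ ψ t (Q : V -> Prop) :
  t ∈ M ->
  (forall a, a ∈ M -> sat M (a :: env) φ <-> a = t) ->
  (forall a, a ∈ M -> sat M (a :: env) ψ <-> Q a) ->
  sat M env (fEx (fAnd φ ψ)) <-> Q t.
Proof.
  intros Ht Hφ Hψ. rewrite sat_ex. split.
  - intros [a [Ha K]]. apply sat_and in K. rewrite Hφ, Hψ in K by exact Ha.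
    destruct K as [-> K]. exact K.
  - intro K. exists t. rewrite sat_and, Hφ, Hψ by exact Ht. auto.
Qed.

(** Turns an equation with a comprehension term into the defining property of that term, which can
    be reified further. *)
Lemma eq_setP (t : V) (P : V -> Prop) :
  (forall x, x ∈ t <-> P x) -> forall a, a = t <-> forall x, x ∈ a <-> P x.
Proof.
  intros H a. split; [intros -> ; exact H |].
  intro K. apply zf_extensionality. intro x. rewrite H. apply K.
Qed.

End Model.

Lemma eq_emptyP {V : ZF} (a : V) : a = empty <-> forall x, ~ x ∈ a.
Proof.
  split; [intros ->; exact emptyP |]. intro K. apply zf_extensionality.
  intro x. generalize (K x) (emptyP x). tauto.
Qed.

Lemma restrict_predP {V : ZF} (r f x z : V) :
  z ∈ restrict_pred r f x <->
  z ∈ f /\ exists u v, z = opair u v /\ opair u x ∈ r.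
Proof.
  apply (setofP (fun z => z ∈ f /\ exists u v, z = opair u v /\ opair u x ∈ r)).
  apply separation.
Qed.

(* Automation: membership in the model and reification *)
Create HintDb inM.
Hint Resolve upair_M opair_M bigcup_M succ_M numeral_M empty_M : inM.
Ltac crush_hyps :=
  repeat match goal with
  | H : exists _, _ |- _ => destruct H
  | H : _ /\ _ |- _ => destruct H
  | H : _ \/ _ |- _ => destruct H
  end; subst.

Ltac learn H :=
  let T := type of H in
  lazymatch goal with _ : T |- _ => fail | _ => pose proof H end.

(** Closes goals [_ ∈ M] by saturating the context with members of [M]. *)
Ltac inM :=
  solve [ assumption | auto 20 with inM |
    unfold at_query in *;
    match goal with HM : transitive_model ?M [] |- _ =>
      repeat match goal with
      | H : ?x ∈ ?y |- _ =>
          lazymatch goal with _ : x ∈ M |- _ => fail | _ => idtac end;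
          pose proof (M_trans M HM x y H ltac:(auto with inM nocore))
      | H : opair _ _ ∈ M |- _ => learn (opair_M_l M HM _ _ H)
      | H : opair _ _ ∈ M |- _ => learn (opair_M_r M HM _ _ H)
      | H : succ _ ∈ M |- _ => learn (succ_M_inv M HM _ H)
      end
    end; auto 20 with inM ].

(** An existential witness is shown to lie in [M]. For a universal quantifier the body has to hold
    vacuously outside [M]: some hypothesis in it would put the variable into [M]. *)
Ltac bounded :=
  intros; crush_hyps;
  match goal with
  | HM : transitive_model ?M [], N : ~ _ ∈ ?M |- _ =>
      try split; try intro; intros; crush_hyps; exfalso; apply N; inM
  | |- _ ∈ _ => inM
  end.

Ltac index x env :=
  lazymatch env with
  | x :: _ => constr:(0)
  | _ :: ?env => let n := index x env in constr:(S n)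
  end.

Ltac reify_let_of T :=
  lazymatch goal with
  | |- sat ?M ?env _ <-> ?G =>
      lazymatch eval pattern T in G with
      | ?Q _ => eapply (reify_let M env _ _ T Q);
          [unfold at_query; inM | intros ? ?; reify | intros ? ?; reify]
      end
  end
(* For a term without an index, [k] is dropped: the whole atom is reified again after [reify_let]
   has put a variable in place of the term. *)
with reify_var x k :=
  lazymatch goal with
  | |- sat _ ?env _ <-> _ =>
      tryif (let i := index x env in idtac)
      then (let i := index x env in k i)
      else reify_let_of x
  end
with reify :=
  cbv beta;
  lazymatch goal with
  | |- sat _ _ _ <-> ?A /\ ?B => eapply reify_and; reify
  | |- sat _ _ _ <-> ?A \/ ?B => eapply reify_or; reify
  | |- sat _ _ _ <-> (?A <-> ?B) => eapply reify_iff; reify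
  | |- sat _ _ _ <-> ~ ?A => eapply reify_not; reify
  | |- sat _ _ _ <-> exists a, _ =>
      eapply reify_ex; [bounded | intros ? ?; reify]
  | |- sat ?M ?env _ <-> ?x ∈ ?M =>
      let i := index x env in eapply (reify_true _ _ i); inM
  | |- sat _ _ _ <-> ?x ∈ ?y =>
      reify_var x ltac:(fun i => reify_var y ltac:(fun j =>
        eapply (reify_mem _ _ i j); reflexivity))
  | |- sat _ _ _ <-> ?x = ?t => reify_var x ltac:(fun i => reify_eq_to i t)
  | |- sat _ _ _ <-> (?A -> ?B) => eapply reify_imp; reify
  | |- sat _ _ _ <-> forall a, _ =>
      eapply reify_all; [bounded | intros ? ?; reify]
  end
with reify_eq_to i t :=
  lazymatch t with
  | opair ?a ?b =>
      reify_var a ltac:(fun j => reify_var b ltac:(fun k =>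
        eapply (reify_opair _ ltac:(eassumption) _ i j k);
          try reflexivity; inM))
  | at_query _ _ _ _ => unfold at_query; reify
  | numeral _ => cbn [numeral]; reify
  | empty => rewrite eq_emptyP; reify
  | succ ?a => rewrite (eq_setP _ _ (succP a)); reify
  | bigcup ?a => rewrite (eq_setP _ _ (bigcupP a)); reify
  | restrict_pred ?r ?f ?x =>
      rewrite (eq_setP _ _ (restrict_predP r f x)); reify
  | _ => reify_var t ltac:(fun j => eapply (reify_eq _ _ i j); reflexivity)
  end.

Ltac separate zs A Q :=
  eapply (separation_M _ ltac:(eassumption) _ zs A Q);
  [inM | repeat constructor; inM | intros ? ?; reify].

(** * The formulas of the recursions *)

(** The arity bound is postponed by [cycle 1], since it can be checked only once reification has
    instantiated the formula. *)
Ltac kind :=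
  eexists; split; cycle 1; [intros V M HM; intros |].

(** Makes the quantifier over [g] in [wfrec_inP] a bounded one. *)
Lemma restrict_pred_M {V : ZF} (M : V) (HM : transitive_model M []) r f x :
  r ∈ M -> f ∈ M -> x ∈ M -> restrict_pred r f x ∈ M.
Proof.
  intros Hr Hf Hx.
  assert (exists B, B ∈ M /\ forall z, z ∈ B <->
    z ∈ f /\ exists u v, z = opair u v /\ opair u x ∈ r) as [B [HB K]].
  { separate [r; x] f (fun z => exists u v, z = opair u v /\ opair u x ∈ r). }
  replace (restrict_pred r f x) with B; [exact HB |].
  apply zf_extensionality. intro z. rewrite K. symmetry. apply restrict_predP.
Qed.
Hint Resolve restrict_pred_M : inM.

(** Each pair in [f] is justified by an earlier one. Neither functionality nor a domain is
    prescribed, because well-foundedness already makes every pair correct. *)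
Definition union_iterates_in {V : ZF} (M a n y : V) : Prop :=
  exists f, f ∈ M /\ opair n y ∈ f /\
    forall m v, opair m v ∈ f ->
      (m = empty /\ v = a) \/
      exists m' v', m = succ m' /\ opair m' v' ∈ f /\ v = bigcup v'.

(** Correctness of a witness is $\in$-induction on [n]. Conversely, the witness for [S k] adds a
    single pair to the one for [k], so Pairing and Union keep it in [M]. *)
Lemma union_iterates_inP {V : ZF} (M : V) (HM : transitive_model M []) a n y :
  a ∈ M ->
  union_iterates_in M a n y <->
  exists k, n = numeral k /\ y = Nat.iter k bigcup a.
Proof.
  intro Ha. split.
  - intros [f [Hf [Hny K]]]. revert y Hny.
    induction n as [n IH] using (well_founded_induction mem_wf). intros y Hny.
    destruct (K _ _ Hny) as [[-> ->] | [m [v [-> [Hmv ->]]]]].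
    + exists 0. auto.
    + destruct (IH m) with (y := v) as [k [-> ->]];
        [apply succP; auto | exact Hmv |].
      exists (S k). auto.
  - intros [k [-> ->]].
    assert (I : forall k, Nat.iter k bigcup a ∈ M).
    { induction k0; simpl; auto with inM. }
    induction k as [| k IH].
    + exists (upair (opair empty a) (opair empty a)).
      split; [inM |]. split; [apply upairP; auto |].
      intros m v H. apply upairP in H.
      assert (E : opair m v = opair empty a) by tauto.
      apply opair_inj in E. auto.
    + destruct IH as [f [Hf [Hk K]]].
      set (z := opair (numeral (S k)) (Nat.iter (S k) bigcup a)).
      destruct (union2 M HM f (upair z z)) as [g [Hg E]].
      exists g. split; [apply Hg; [exact Hf |]; subst z; auto with inM |].
      split; [apply E; right; apply upairP; auto |].
      intros m v H. apply E in H. destruct H as [H | H].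
      * destruct (K _ _ H) as [L | [m' [v' [E1 [H' E2]]]]]; [auto |].
        right. exists m', v'. rewrite E. auto.
      * right. apply upairP in H.
        assert (L : opair m v = z) by tauto. apply opair_inj in L.
        destruct L as [-> ->]. exists (numeral k), (Nat.iter k bigcup a).
        rewrite E. auto.
Qed.

(** Transparent, like the other instances, because their distinctness is decided by evaluating the
    formulas. *)
Definition union_iterates : {χ | union_iterates_kind χ}.
Proof.
  kind.
  - rewrite <- union_iterates_inP by eassumption.
    unfold union_iterates_in. reify.
  - bound_arity.
Defined.

(** Naming the restriction [g] gives it an index, so that it is described once and not at each
    occurrence inside the step [H]. *)
Lemma wfrec_inP {V : ZF} (M r : V) (H : V -> V -> V -> Prop) x z :
  wfrec_in M r H x z <->
  exists y f, y ∈ M /\ f ∈ M /\ z = opair x y /\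
    ((forall z, z ∈ f -> exists x y, z = opair x y) /\
     (forall u, (exists y, opair u y ∈ f) <-> opair u x ∈ r) /\
     (forall x y y', opair x y ∈ f -> opair x y' ∈ f -> y = y') /\
     (forall x y g, opair x y ∈ f -> g = restrict_pred r f x -> H x g y)) /\
    H x f y.
Proof.
  unfold wfrec_in, is_recfun. split.
  - intros [y [f K]]. exists y, f. intuition (subst; auto).
  - intros [y [f K]]. exists y, f. intuition eauto.
Qed.

Definition union_recursion : {χ | union_recursion_kind χ}.
Proof.
  kind.
  - rewrite wfrec_inP. unfold step_iter_union. reify.
  - bound_arity.
Defined.

Definition rank : {χ | rank_kind χ}.
Proof.
  kind.
  - rewrite wfrec_inP. unfold step_rank. reify.
  - bound_arity.
Defined.

Definition cumulative : {χ | cumulative_kind χ}.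
Proof.
  kind.
  - rewrite wfrec_inP. unfold step_cumulative. reify.
  - bound_arity.
Defined.

Definition check_recursion : {χ | check_recursion_kind χ}.
Proof.
  kind.
  - rewrite wfrec_inP. unfold step_check. reify.
  - bound_arity.
Defined.

Definition atomic_forcing : {χ | atomic_forcing_kind χ}.
Proof.
  kind.
  - rewrite wfrec_inP. unfold step_atomic_forcing, dense_below, in_dom.
    cbv zeta. reify.
  - bound_arity.
Defined.

(** * Transitive closures and check-names *)

Lemma opair_transitive_l {V : ZF} (T a b : V) :
  transitive_set T -> opair a b ∈ T -> a ∈ T.
Proof.
  intros HT H. apply (HT (upair a a)); [| apply upairP; auto].
  apply (HT (opair a b)); [exact H | apply upairP; auto].
Qed.

Section Closure.
Context {V : ZF} (M : V) (HM : transitive_model M []).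

Lemma replacement_M φ zs A (Q : V -> V -> Prop) :
  sat M [] (Replacement φ) -> A ∈ M -> Forall (fun z => z ∈ M) zs ->
  (forall x y, x ∈ M -> y ∈ M -> (sat M (x :: y :: zs) φ <-> Q x y)) ->
  (forall x y y', x ∈ A -> Q x y -> Q x y' -> y = y') ->
  exists Y, Y ∈ M /\ forall y, y ∈ M -> (y ∈ Y <-> exists x, x ∈ A /\ Q x y).
Proof.
  intros HR HA Hzs HQ U.
  set (zs' := map (fun i => nth i zs empty) (seq 0 (arity φ - 2))).
  assert (E : forall x y, x ∈ M -> y ∈ M ->
    sat M (x :: y :: zs') φ <-> Q x y).
  { intros x y Hx Hy. rewrite <- HQ by assumption.
    apply sat_ext. intros [| [| n]] Hn; simpl; [reflexivity .. |].
    apply (nth_map_seq (fun i => nth i zs empty)). lia. }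
  destruct (proj1 (sat_Replacement M φ) HR zs') with (A := A) as [Y [HY K]].
  - unfold zs'. rewrite length_map, length_seq. reflexivity.
  - apply Forall_map, Forall_forall. intros i _. apply nth_M; assumption.
  - exact HA.
  - intros x Hx HxA y Hy y' Hy'. rewrite !E by assumption.
    intros [H H']. exact (U x y y' HxA H H').
  - exists Y. split; [exact HY |]. intros y Hy. rewrite (K y Hy). split.
    + intros [x [Hx [HxA H]]]. apply E in H; eauto.
    + intros [x [HxA H]]. exists x. rewrite E by inM. split; [inM | auto].
Qed.

(** A Kuratowski pair of elements of $A\cup B$ lies in the second power set of $A\cup B$. A superset
    of the product is enough, as Separation is always applied to it. *)
Lemma product_M A B :
  A ∈ M -> B ∈ M ->
  exists C, C ∈ M /\ forall a b, a ∈ A -> b ∈ B -> opair a b ∈ C.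
Proof.
  intros HA HB. destruct (union2 M HM A B) as [U [HU KU]].
  destruct (powerset_M M HM U (HU HA HB)) as [P [HP KP]].
  destruct (powerset_M M HM P HP) as [C [HC KC]].
  exists C. split; [exact HC |]. intros a b Ha Hb.
  assert (K : forall c d, c ∈ U -> d ∈ U -> upair c d ∈ P).
  { intros c d Hc Hd. specialize (HU HA HB). apply KP; [inM |].
    intros z Hz. apply upairP in Hz. destruct Hz; subst; assumption. }
  apply KC; [inM |]. intros z Hz. apply upairP in Hz.
  destruct Hz; subst; apply K; apply KU; auto.
Qed.

(* Abstract: unification could try to evaluate [sat] on an explicit formula. *)
Context (χ : formula) (Hχ : union_iterates_kind χ).
Context (HR : sat M [] (Replacement χ)).

(** Take $\bigcup_k\bigcup^k\{a\}$; starting from $\{a\}$ puts [a] itself into it. Any transitive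
    set containing [a] would do, so minimality is not claimed. *)
Lemma transitive_closure_M a :
  a ∈ M -> exists T, T ∈ M /\ transitive_set T /\ a ∈ T.
Proof.
  intro Ha. set (b := upair a a).
  assert (Hb : b ∈ M) by (unfold b; inM).
  assert (Hk : forall k, Nat.iter k bigcup b ∈ M).
  { induction k; simpl; auto with inM. }
  destruct (infinity_M M HM) as [I [HI KI]].
  destruct (replacement_M χ [b] I
    (fun x y => exists k, x = numeral k /\ y = Nat.iter k bigcup b))
    as [Y [HY KY]].
  - exact HR.
  - exact HI.
  - auto.
  - intros x y Hx Hy. apply Hχ; assumption.
  - intros x y y' _ [k [-> ->]] [l [E ->]]. apply numeral_inj in E.
    congruence.
  - exists (bigcup Y). repeat split; [inM | |].
    + intros x y Hx Hy. rewrite bigcupP in *. destruct Hx as [u [Hu Hx]].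
      pose proof (M_trans M HM _ _ Hu HY) as HuM.
      apply (KY u HuM) in Hu. destruct Hu as [n [Hn [k [-> ->]]]].
      exists (Nat.iter (S k) bigcup b). rewrite KY by apply Hk. split.
      * exists (numeral (S k)). eauto.
      * simpl. apply bigcupP. eauto.
    + apply bigcupP. exists b. rewrite KY by exact Hb. split.
      * exists (numeral 0). split; [apply KI |]. exists 0. auto.
      * apply upairP. auto.
Qed.

End Closure.

(** [R] is a post-fixed point of the defining clause of [check], so that
    [opair u w ∈ R] implies [w = check one u]. *)
Definition check_post_fixed {V : ZF} (one R : V) : Prop :=
  forall u w, opair u w ∈ R ->
    (forall u', u' ∈ u -> exists w', opair u' w' ∈ R /\ opair w' one ∈ w) /\
    (forall z, z ∈ w ->
       exists u' w', u' ∈ u /\ opair u' w' ∈ R /\ z = opair w' one).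

Definition checks_in {V : ZF} (M one x y : V) : Prop :=
  exists R, R ∈ M /\ opair x y ∈ R /\ check_post_fixed one R.

Lemma checks_in_sound {V : ZF} (M one x y : V) :
  checks_in M one x y -> y = check one x.
Proof.
  intros [R [_ [Hxy HR]]]. revert y Hxy.
  induction x as [x IH] using (well_founded_induction mem_wf). intros y Hxy.
  destruct (HR _ _ Hxy) as [K1 K2].
  apply zf_extensionality. intro z. rewrite checkP. split.
  - intro Hz. destruct (K2 _ Hz) as [u [w [Hu [Huw ->]]]].
    rewrite (IH u Hu w Huw). eauto.
  - intros [u [Hu ->]]. destruct (K1 _ Hu) as [w [Huw Hw]].
    rewrite <- (IH u Hu w Huw). exact Hw.
Qed.

(** That [check one x] lies in [M] is assumed because its transitive closure [S] bounds the values
    of the witnessing relation; [check_graph] reads it off from $\langle x,\check x\rangle\in M$. *)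
Lemma checks_in_complete {V : ZF} (M one x : V) χ :
  transitive_model M [] -> union_iterates_kind χ -> sat M [] (Replacement χ) ->
  one ∈ M -> x ∈ M -> check one x ∈ M -> checks_in M one x (check one x).
Proof.
  intros HM Hχ HR H1 Hx. 
  induction x as [x IH] using (well_founded_induction mem_wf). intro Hy.
  destruct (transitive_closure_M M HM χ Hχ HR x Hx) as [T [HT [TT HxT]]].
  destruct (transitive_closure_M M HM χ Hχ HR _ Hy) as [S [HS [TS HyS]]].
  destruct (product_M M HM T S HT HS) as [C [HC KC]].
  set (y := check one x) in *.
  (* All pairs that have some witness are collected at once, so no witness has to be chosen for each
     element of [x]; only the pair of [x] and [y] is new. *)
  assert (exists R, R ∈ M /\ forall z, z ∈ R <-> z ∈ C /\
    exists u w, z = opair u w /\ u ∈ T /\ w ∈ S /\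
      (checks_in M one u w \/ (u = x /\ w = y))) as [R [HRM KR]].
  { unfold checks_in, check_post_fixed.
    match goal with |- exists R, R ∈ M /\ forall z, _ <-> _ /\ @?Q z =>
      separate [one; T; S; x; y] C Q end. }
  assert (E : forall u w, opair u w ∈ R <->
    u ∈ T /\ w ∈ S /\ (checks_in M one u w \/ (u = x /\ w = y))).
  { intros u w. rewrite KR. split.
    - intros [_ [u' [w' [E K]]]]. apply opair_inj in E. destruct E as [-> ->].
      exact K.
    - intro K. split; [apply KC; tauto | eauto]. }
  exists R. split; [exact HRM |]. split; [apply E; auto |].
  intros u w Huw. apply E in Huw. destruct Huw as [Hu [Hw [Huw | [-> ->]]]].
  - destruct Huw as [R' [HR' [Huw KR']]]. destruct (KR' _ _ Huw) as [K1 K2].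
    split.
    + intros u' Hu'. destruct (K1 u' Hu') as [w' [Hw' Hw1]].
      exists w'. split; [| exact Hw1]. apply E.
      split; [exact (TT _ _ Hu Hu') |].
      split; [exact (opair_transitive_l _ _ _ TS (TS _ _ Hw Hw1)) |].
      left. exists R'. auto.
    + intros z Hz. destruct (K2 z Hz) as [u' [w' [Hu' [Hw' ->]]]].
      exists u', w'. split; [exact Hu' |]. split; [| reflexivity]. apply E.
      split; [exact (TT _ _ Hu Hu') |].
      split; [exact (opair_transitive_l _ _ _ TS (TS _ _ Hw Hz)) |].
      left. exists R'. auto.
  - assert (K : forall u, u ∈ x ->
      opair (check one u) one ∈ y /\ opair u (check one u) ∈ R).
    { intros u Hux. assert (Hu' : opair (check one u) one ∈ y)
        by (apply checkP; eauto).
      split; [exact Hu' |]. apply E. split; [exact (TT _ _ HxT Hux) |].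
      split; [exact (opair_transitive_l _ _ _ TS (TS _ _ HyS Hu')) |].
      left. apply IH; inM. }
    split.
    + intros u Hux. exists (check one u). destruct (K u Hux). auto.
    + intros z Hz. apply checkP in Hz. destruct Hz as [u [Hux ->]].
      exists u, (check one u). destruct (K u Hux). auto.
Qed.

Lemma Z_plus_replacement_mono {V : ZF} (M : V) Θ :
  transitive_model M Θ -> transitive_model M [].
Proof.
  intros [H K]. split; [exact H |]. intros σ [Hσ | [χ [[] _]]].
  apply K. left. exact Hσ.
Qed.

Lemma model_Replacement {V : ZF} (M : V) Θ χ :
  transitive_model M Θ -> In χ Θ -> sat M [] (Replacement χ).
Proof. intros [_ H] Hχ. apply H. right. eauto. Qed.

Definition check_graph :
  {χ | check_graph_kind [proj1_sig union_iterates; proj1_sig union_recursion;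
         proj1_sig rank; proj1_sig cumulative; proj1_sig check_recursion;
         proj1_sig atomic_forcing] χ}.
Proof.
  eexists; split; cycle 1; [intros V M HΘ x z one Hx Hz H1 |].
  - pose proof (Z_plus_replacement_mono M _ HΘ) as HM.
    assert (E : z = opair x (check one x) <->
      exists y, y ∈ M /\ z = opair x y /\ checks_in M one x y).
    { split.
      - intros ->. exists (check one x).
        split; [exact (opair_M_r M HM _ _ Hz) |].
        split; [reflexivity |].
        apply checks_in_complete with (proj1_sig union_iterates);
          [exact HM | apply proj2_sig | | exact H1 | exact Hx
          | exact (opair_M_r M HM _ _ Hz)].
        exact (model_Replacement M _ _ HΘ (in_eq _ _)).
      - intros [y [_ [-> K]]]. apply checks_in_sound in K.
        congruence. }
    rewrite E. unfold checks_in, check_post_fixed. clear HΘ E. reify.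
  - bound_arity.
Defined.

(** * Forcing of atomic formulas *)

Section AtomicForcing.
Context {V : ZF} (M P leq : V).

(** The parameter [E] stands for forced equality. It is instantiated by membership in a post-fixed
    set, by [forces_eq], and by satisfaction of the translated formula. *)
Definition forces_mem (E : V -> V -> V -> Prop) (p a b : V) : Prop :=
  dense_below P leq p (fun q => q ∈ P /\ opair q p ∈ leq /\
    exists s r, opair s r ∈ b /\ opair q r ∈ leq /\ E q a s).

Definition forces_incl (E : V -> V -> V -> Prop) (p a b : V) : Prop :=
  forall s r q, opair s r ∈ a -> q ∈ P -> opair q p ∈ leq ->
    opair q r ∈ leq -> forces_mem E q s b.

(** The clause "p forces a ⊆ b and b ⊆ a" is monotone in the relation it
    refers to, so forcing of equalities is its greatest fixed point. *)
Definition forces_eq (p a b : V) : Prop :=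
  exists W, W ∈ M /\
    (forall p a b, opair p (opair a b) ∈ W ->
       forces_incl (fun q s t => opair q (opair s t) ∈ W) p a b /\
       forces_incl (fun q s t => opair q (opair s t) ∈ W) p b a) /\
    opair p (opair a b) ∈ W.

End AtomicForcing.

Definition feq : {φ | arity φ <= 6 /\
  forall (V : ZF) (M : V), transitive_model M [] -> forall p P leq one a b,
    p ∈ M -> P ∈ M -> leq ∈ M -> one ∈ M -> a ∈ M -> b ∈ M ->
    sat M [p; P; leq; one; a; b] φ <-> forces_eq M P leq p a b}.
Proof.
  eexists; split; cycle 1; [intros V M HM; intros |].
  - unfold forces_eq, forces_incl, forces_mem, dense_below. reify.
  - bound_arity.
Defined.

Definition fmem : {φ | arity φ <= 6 /\
  forall (V : ZF) (M : V), transitive_model M [] -> forall p P leq one a b,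
    p ∈ M -> P ∈ M -> leq ∈ M -> one ∈ M -> a ∈ M -> b ∈ M ->
    sat M [p; P; leq; one; a; b] φ <->
    forces_mem P leq (forces_eq M P leq) p a b}.
Proof.
  eexists; split; cycle 1; [intros V M HM; intros |].
  - unfold forces_eq, forces_incl, forces_mem, dense_below. reify.
  - bound_arity.
Defined.

(** * Forced equality as a fixed point and as a congruence *)

Section Forcing.
Context {V : ZF} (M P leq one : V) (HM : transitive_model M []).
Context (χ : formula) (Hχ : union_iterates_kind χ).
Context (HR : sat M [] (Replacement χ)).
Context (HF : forcing_notion P leq one) (HP : P ∈ M) (Hleq : leq ∈ M).

Local Notation "q ≼ p" := (opair q p ∈ leq) (at level 70).
Local Notation fe := (forces_eq M P leq).
Local Notation fm := (forces_mem P leq fe).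
Local Notation fi := (forces_incl P leq fe).

Lemma leq_refl p : p ∈ P -> p ≼ p.
Proof. apply HF. Qed.

Lemma leq_trans p q r : p ≼ q -> q ≼ r -> p ≼ r.
Proof. apply HF. Qed.

Lemma leq_r p q : p ≼ q -> q ∈ P.
Proof.
  intro H. destruct (proj1 HF _ H) as [p' [q' [_ [Hq E]]]].
  apply opair_inj in E. destruct E as [_ ->]. exact Hq.
Qed.

Lemma name_M s r a : opair s r ∈ a -> a ∈ M -> s ∈ M.
Proof. intros. inM. Qed.

Lemma forces_mem_impl E E' p a a' b :
  (forall q s r, q ∈ P -> q ≼ p -> opair s r ∈ b -> E q a s -> E' q a' s) ->
  forces_mem P leq E p a b -> forces_mem P leq E' p a' b.
Proof.
  intros H K q Hq Hqp. destruct (K q Hq Hqp) as [d [[Hd [Hdp K']] Hdq]].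
  destruct K' as [s [r [Hsr [Hdr Hs]]]].
  exists d. split; [| exact Hdq]. repeat split; try assumption. eauto 8.
Qed.

Lemma forces_mem_dense E p a b :
  (forall q, q ∈ P -> q ≼ p ->
     exists d, d ∈ P /\ d ≼ q /\ forces_mem P leq E d a b) ->
  forces_mem P leq E p a b.
Proof.
  intros H q Hq Hqp. destruct (H q Hq Hqp) as [d [Hd [Hdq K]]].
  destruct (K d Hd (leq_refl d Hd)) as [c [[Hc [Hcd K']] _]].
  pose proof (leq_trans _ _ _ Hcd Hdq) as Hcq.
  exists c. split; [| exact Hcq]. split; [exact Hc |].
  split; [exact (leq_trans _ _ _ Hcq Hqp) | exact K'].
Qed.

Lemma forces_mem_le E p q a b :
  q ≼ p -> forces_mem P leq E p a b -> forces_mem P leq E q a b.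
Proof.
  intros Hqp K c Hc Hcq.
  destruct (K c Hc (leq_trans _ _ _ Hcq Hqp)) as [d [[Hd [_ K']] Hdc]].
  exists d. split; [| exact Hdc]. split; [exact Hd |].
  split; [exact (leq_trans _ _ _ Hdc Hcq) | exact K'].
Qed.

Lemma forces_mem_intro E p a b s r :
  opair s r ∈ b -> p ≼ r -> (forall q, q ∈ P -> q ≼ p -> E q a s) ->
  forces_mem P leq E p a b.
Proof.
  intros Hs Hpr H q Hq Hqp. exists q. split; [| exact (leq_refl q Hq)].
  split; [exact Hq |]. split; [exact Hqp |]. exists s, r.
  split; [exact Hs |]. split; [exact (leq_trans _ _ _ Hqp Hpr) | auto].
Qed.

(** All triples in a witness [W] are forced with the same witness, so monotonicity replaces
    membership in [W] by [fe]. *)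
Lemma forces_eq_unfold p a b : fe p a b -> fi p a b /\ fi p b a.
Proof.
  intros [W [HW [K H]]].
  destruct (K p a b H) as [Hab Hba].
  assert (I : forall q s t, opair q (opair s t) ∈ W -> fe q s t)
    by (intros; exists W; auto).
  split; intros s r q Hs Hq Hqp Hqr;
    [apply forces_mem_impl with (2 := Hab s r q Hs Hq Hqp Hqr) |
     apply forces_mem_impl with (2 := Hba s r q Hs Hq Hqp Hqr)];
    intros d t r' _ _ _; apply I.
Qed.

(** Needs one witness for all the equalities that the two inclusions refer to. Separation provides
    it: the triples of $P\times T\times T$ that satisfy [fe], together with the new one, where [T]
    is transitive and contains both names. *)
Lemma forces_eq_fold p a b :
  p ∈ P -> a ∈ M -> b ∈ M -> fi p a b -> fi p b a -> fe p a b.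
Proof.
  intros Hp Ha Hb Hab Hba.
  destruct (transitive_closure_M M HM χ Hχ HR a Ha) as [A [HA [TA HaA]]].
  destruct (transitive_closure_M M HM χ Hχ HR b Hb) as [B [HB [TB HbB]]].
  destruct (union2 M HM A B) as [T [HT KT]]. specialize (HT HA HB).
  assert (TT : transitive_set T).
  { intros x y Hx Hy. apply KT in Hx. apply KT.
    destruct Hx; [left; apply (TA x) | right; apply (TB x)]; assumption. }
  assert (HaT : a ∈ T) by (apply KT; auto).
  assert (HbT : b ∈ T) by (apply KT; auto).
  destruct (product_M M HM T T HT HT) as [TxT [HTT KTT]].
  destruct (product_M M HM P TxT HP HTT) as [C [HC KC]].
  assert (exists W, W ∈ M /\ forall z, z ∈ W <-> z ∈ C /\
    exists q s t, z = opair q (opair s t) /\ q ∈ P /\ s ∈ T /\ t ∈ T /\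
      (fe q s t \/ (q = p /\ s = a /\ t = b))) as [W [HW KW]].
  { unfold forces_eq, forces_incl, forces_mem, dense_below.
    assert (p ∈ M) by inM.
    match goal with |- exists W, W ∈ M /\ forall z, _ <-> _ /\ @?Q z =>
      separate [P; leq; T; p; a; b] C Q end. }
  assert (E : forall q s t, opair q (opair s t) ∈ W <->
    q ∈ P /\ s ∈ T /\ t ∈ T /\ (fe q s t \/ (q = p /\ s = a /\ t = b))).
  { intros q s t. rewrite KW. split.
    - intros [_ [q' [s' [t' [E K]]]]]. apply opair_inj in E.
      destruct E as [-> E]. apply opair_inj in E. destruct E as [-> ->].
      exact K.
    - intro K. split; [apply KC; [| apply KTT]; tauto | eauto 8]. }
  (* The clause for names in [T] refers only to names in their domains, which are again in [T];
     restricting [fe] to [T] loses nothing. *)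
  assert (L : forall q s t, s ∈ T -> t ∈ T -> fi q s t ->
    forces_incl P leq (fun q s t => opair q (opair s t) ∈ W) q s t).
  { intros q s t Hs Ht K u r d Hu Hd Hdq Hdr.
    apply forces_mem_impl with (2 := K u r d Hu Hd Hdq Hdr).
    intros c v r' Hc _ Hv Hcuv. apply E. split; [exact Hc |].
    split; [exact (opair_transitive_l _ _ _ TT (TT _ _ Hs Hu)) |].
    split; [exact (opair_transitive_l _ _ _ TT (TT _ _ Ht Hv)) | auto]. }
  exists W. split; [exact HW |]. split.
  - intros q s t H. apply E in H. destruct H as [_ [Hs [Ht H]]].
    assert (fi q s t /\ fi q t s).
    { destruct H as [H | [-> [-> ->]]]; [apply forces_eq_unfold, H | auto]. }
    split; apply L; tauto.
  - apply E. auto 10.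
Qed.

Lemma forces_eq_sym p a b :
  p ∈ P -> a ∈ M -> b ∈ M -> fe p a b -> fe p b a.
Proof.
  intros Hp Ha Hb H. apply forces_eq_unfold in H.
  apply forces_eq_fold; tauto.
Qed.

Lemma forces_eq_le p q a b :
  q ∈ P -> a ∈ M -> b ∈ M -> q ≼ p -> fe p a b -> fe q a b.
Proof.
  intros Hq Ha Hb Hqp H. apply forces_eq_unfold in H. destruct H as [H1 H2].
  apply forces_eq_fold; try assumption; intros s r d Hs Hd Hdq Hdr;
    [apply (H1 s r) | apply (H2 s r)]; try assumption;
    exact (leq_trans _ _ _ Hdq Hqp).
Qed.

Lemma forces_eq_refl a : a ∈ M -> forall p, p ∈ P -> fe p a a.
Proof.
  induction a as [a IH] using (well_founded_induction in_dom_wf).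
  intros Ha p Hp.
  assert (fi p a a).
  { intros s r q Hs Hq _ Hqr. apply (forces_mem_intro _ _ _ _ s r Hs Hqr).
    intros d Hd _. apply IH; [exists r; exact Hs | | exact Hd].
    exact (name_M _ _ _ Hs Ha). }
  apply forces_eq_fold; assumption.
Qed.

Lemma forces_eq_trans a : a ∈ M -> forall p b c,
  p ∈ P -> b ∈ M -> c ∈ M -> fe p a b -> fe p b c -> fe p a c.
Proof.
  induction a as [a IH] using (well_founded_induction in_dom_wf).
  intros Ha p b c Hp Hb Hc Hab Hbc.
  apply forces_eq_unfold in Hab, Hbc.
  destruct Hab as [Hab Hba], Hbc as [Hbc Hcb].
  apply forces_eq_fold; try assumption.
  - intros s r q Hs Hq Hqp Hqr. apply forces_mem_dense. intros q1 Hq1 Hq1q.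
    destruct (Hab s r q Hs Hq Hqp Hqr q1 Hq1 Hq1q)
      as [d [[Hd [Hdq [t [r1 [Ht [Hdr1 Hst]]]]]] Hdq1]].
    exists d. split; [exact Hd |]. split; [exact Hdq1 |].
    apply forces_mem_impl with
      (2 := Hbc t r1 d Ht Hd (leq_trans _ _ _ Hdq Hqp) Hdr1).
    intros e u r2 He Hed Hu Htu.
    pose proof (name_M _ _ _ Hs Ha). pose proof (name_M _ _ _ Ht Hb).
    pose proof (name_M _ _ _ Hu Hc).
    apply IH with (b := t); try assumption; [exists r; exact Hs |].
    apply (forces_eq_le d); assumption.
  - intros u r q Hu Hq Hqp Hqr. apply forces_mem_dense. intros q1 Hq1 Hq1q.
    destruct (Hcb u r q Hu Hq Hqp Hqr q1 Hq1 Hq1q)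
      as [d [[Hd [Hdq [t [r1 [Ht [Hdr1 Hut]]]]]] Hdq1]].
    exists d. split; [exact Hd |]. split; [exact Hdq1 |].
    apply forces_mem_impl with
      (2 := Hba t r1 d Ht Hd (leq_trans _ _ _ Hdq Hqp) Hdr1).
    intros e s r2 He Hed Hs Hts.
    pose proof (name_M _ _ _ Hs Ha). pose proof (name_M _ _ _ Ht Hb).
    pose proof (name_M _ _ _ Hu Hc).
    (* The induction hypothesis starts from a name in the domain of [a], so the chain from [u]
       through [t] to [s] is read backwards. *)
    apply forces_eq_sym; try assumption.
    apply IH with (b := t); try assumption; [exists r2; exact Hs | |];
      apply forces_eq_sym; try assumption.
    apply (forces_eq_le d); assumption.
Qed.

Lemma forces_mem_subst p s a b :
  s ∈ M -> a ∈ M -> b ∈ M -> fe p a b -> fm p s a -> fm p s b.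
Proof.
  intros Hs Ha Hb Hab H. apply forces_eq_unfold in Hab. destruct Hab as [Hab _].
  apply forces_mem_dense. intros q Hq Hqp.
  destruct (H q Hq Hqp) as [d [[Hd [Hdp [t [r [Ht [Hdr Hst]]]]]] Hdq]].
  exists d. split; [exact Hd |]. split; [exact Hdq |].
  apply forces_mem_impl with (2 := Hab t r d Ht Hd Hdp Hdr).
  intros e u r' He Hed Hu Htu.
  pose proof (name_M _ _ _ Ht Ha). pose proof (name_M _ _ _ Hu Hb).
  apply forces_eq_trans with (b := t); try assumption.
  apply (forces_eq_le d); assumption.
Qed.

Lemma forces_eq_dense p a b :
  p ∈ P -> a ∈ M -> b ∈ M ->
  (forall q, q ∈ P -> q ≼ p -> exists d, d ∈ P /\ d ≼ q /\ fe d a b) ->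
  fe p a b.
Proof.
  intros Hp Ha Hb H.
  apply forces_eq_fold; try assumption;
    intros s r q Hs Hq Hqp Hqr; apply forces_mem_dense; intros c Hc Hcq;
    destruct (H c Hc (leq_trans _ _ _ Hcq Hqp)) as [d [Hd [Hdc K]]];
    exists d; (split; [exact Hd |]); (split; [exact Hdc |]);
    apply forces_eq_unfold in K;
    apply (proj1 K s r d) || apply (proj2 K s r d); try assumption;
    try apply (leq_refl d Hd);
    exact (leq_trans _ _ _ Hdc (leq_trans _ _ _ Hcq Hqr)).
Qed.

(** From right to left: below its condition [r], a name [s] of [a] is forced into [a] by
    reflexivity, and the equivalence carries it into [b]. The other direction is substitution, hence
    transitivity. *)
Lemma forces_eq_iff p a b :
  p ∈ P -> a ∈ M -> b ∈ M ->
  fe p a b <->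
  forall s q, in_dom s a \/ in_dom s b -> q ∈ P -> q ≼ p ->
    (fm q s a <-> fm q s b).
Proof.
  intros Hp Ha Hb. split.
  - intros H s q Hs Hq Hqp.
    assert (HsM : s ∈ M) by (destruct Hs as [[r Hs] | [r Hs]]; inM).
    apply (forces_eq_le p q) in H; try assumption.
    split; apply forces_mem_subst; try assumption.
    apply forces_eq_sym; assumption.
  - intro H. apply forces_eq_fold; try assumption; intros s r q Hs Hq Hqp Hqr.
    + apply (H s q); try assumption; [left; exists r; exact Hs |].
      apply (forces_mem_intro _ _ _ _ s r Hs Hqr). intros d Hd _.
      apply forces_eq_refl; [inM | exact Hd].
    + apply (H s q); try assumption; [right; exists r; exact Hs |].
      apply (forces_mem_intro _ _ _ _ s r Hs Hqr). intros d Hd _.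
      apply forces_eq_refl; [inM | exact Hd].
Qed.

(** * Truth of atomic formulas in generic extensions *)

Section Generic.
Context (G : V) (HG : generic_filter M P leq G).

Lemma G_P p : p ∈ G -> p ∈ P.
Proof. apply HG. Qed.

Lemma G_up p q : p ∈ G -> p ≼ q -> q ∈ G.
Proof. intros Hp H. apply (proj1 HG) with p; auto. exact (leq_r _ _ H). Qed.

Lemma G_common p q : p ∈ G -> q ∈ G -> exists r, r ∈ G /\ r ≼ p /\ r ≼ q.
Proof. apply HG. Qed.

Lemma generic_meets (D : V) (Q : V -> Prop) :
  D ∈ M -> (forall p, p ∈ D <-> p ∈ P /\ Q p) ->
  (forall p, p ∈ P -> exists d, d ∈ P /\ d ≼ p /\ Q d) ->
  exists p, p ∈ G /\ Q p.
Proof.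
  intros HD KD H. destruct (proj2 HG D HD) as [p [Hp K]].
  - split; [intros d Hd; apply KD, Hd |]. intros p Hp.
    destruct (H p Hp) as [d [Hd [Hdp K]]]. exists d. rewrite KD. auto.
  - exists p. split; [exact Hp |]. apply KD, K.
Qed.

(** Adding to [B] the conditions incompatible with [p] makes it dense, and the filter [G], which
    contains [p], has no element incompatible with [p]. *)
Lemma generic_meets_below p B (Q : V -> Prop) :
  p ∈ G -> B ∈ M -> (forall q, q ∈ B <-> q ∈ P /\ Q q) ->
  (forall q, q ∈ P -> q ≼ p -> exists d, d ∈ P /\ d ≼ q /\ Q d) ->
  exists q, q ∈ G /\ Q q.
Proof.
  intros Hp HB KB H. assert (HpM : p ∈ M) by (pose proof (G_P p Hp); inM).
  assert (exists D, D ∈ M /\ forall q, q ∈ D <-> q ∈ P /\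
    (q ∈ B \/ ~ exists d, d ∈ P /\ d ≼ q /\ d ≼ p)) as [D [HD KD]].
  { separate [P; leq; B; p] P
      (fun q => q ∈ B \/ ~ exists d, d ∈ P /\ d ≼ q /\ d ≼ p). }
  destruct (generic_meets D _ HD KD) as [q [Hq [K | N]]].
  - intros q Hq.
    destruct (classic (exists d, d ∈ P /\ d ≼ q /\ d ≼ p)) as [K | N].
    + destruct K as [d [Hd [Hdq Hdp]]]. destruct (H d Hd Hdp) as [e [He [Hed K]]].
      exists e. split; [exact He |].
      split; [exact (leq_trans _ _ _ Hed Hdq) |]. left. apply KB. auto.
    + exists q. auto using leq_refl.
  - exists q. split; [exact Hq |]. apply KB, K.
  - destruct N. destruct (G_common q p Hq Hp) as [r [Hr K]].
    exists r. split; [exact (G_P r Hr) | exact K].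
Qed.

Lemma forces_mem_generic p a b :
  p ∈ G -> a ∈ M -> b ∈ M -> fm p a b ->
  exists q s r, q ∈ G /\ r ∈ G /\ opair s r ∈ b /\ fe q a s.
Proof.
  intros Hp Ha Hb H.
  assert (exists B, B ∈ M /\ forall q, q ∈ B <-> q ∈ P /\
    exists s r, opair s r ∈ b /\ q ≼ r /\ fe q a s) as [B [HB KB]].
  { unfold forces_eq, forces_incl, forces_mem, dense_below.
    match goal with |- exists W, W ∈ M /\ forall z, _ <-> _ /\ @?Q z =>
      separate [P; leq; a; b] P Q end. }
  destruct (generic_meets_below p B _ Hp HB KB) as [q [Hq [s [r [Hs [Hqr K]]]]]].
  - intros q Hq Hqp. destruct (H q Hq Hqp) as [d [[Hd [_ K]] Hdq]].
    exists d. auto.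
  - exists q, s, r. split; [exact Hq |]. split; [exact (G_up _ _ Hq Hqr) | auto].
Qed.

Lemma forces_eq_sound a : a ∈ M -> forall b p,
  b ∈ M -> p ∈ G -> fe p a b -> val G a = val G b.
Proof.
  induction a as [a IH] using (well_founded_induction in_dom_wf).
  intros Ha b p Hb Hp Hab. apply forces_eq_unfold in Hab.
  destruct Hab as [Hab Hba].
  apply zf_extensionality. intro x. rewrite !valP. split.
  - intros [s [[r [Hr Hs]] ->]].
    destruct (G_common p r Hp Hr) as [q [Hq [Hqp Hqr]]].
    pose proof (name_M _ _ _ Hs Ha) as HsM.
    destruct (forces_mem_generic q s b Hq HsM Hb)
      as [d [t [r' [Hd [Hr' [Ht K]]]]]].
    { exact (Hab s r q Hs (G_P q Hq) Hqp Hqr). }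
    exists t. split; [eauto |].
    apply (IH s) with d; try assumption; [exists r; exact Hs |].
    exact (name_M _ _ _ Ht Hb).
  - intros [s [[r [Hr Hs]] ->]].
    destruct (G_common p r Hp Hr) as [q [Hq [Hqp Hqr]]].
    pose proof (name_M _ _ _ Hs Hb) as HsM.
    destruct (forces_mem_generic q s a Hq HsM Ha)
      as [d [t [r' [Hd [Hr' [Ht K]]]]]].
    { exact (Hba s r q Hs (G_P q Hq) Hqp Hqr). }
    pose proof (name_M _ _ _ Ht Ha) as HtM.
    exists t. split; [eauto |]. symmetry.
    apply (IH t) with d; try assumption; [exists r'; exact Ht |].
    apply forces_eq_sym; auto using G_P.
Qed.

(** A positive form of forcing $a\not\subseteq b$: [p] forces a specific [s] into [a] and excludes
    it from [b]. *)
Definition forces_not_incl p a b : Prop :=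
  exists s r, opair s r ∈ a /\ p ≼ r /\ ~ exists q, q ∈ P /\ q ≼ p /\ fm q s b.

Lemma not_forces_incl p a b :
  ~ fi p a b -> exists q, q ∈ P /\ q ≼ p /\ forces_not_incl q a b.
Proof.
  intro N. apply NNPP. intro K. apply N. intros s r q Hs Hq Hqp Hqr.
  apply forces_mem_dense. intros d Hd Hdq. apply NNPP. intro K'. apply K.
  exists d. split; [exact Hd |]. split; [exact (leq_trans _ _ _ Hdq Hqp) |].
  exists s, r. split; [exact Hs |]. split; [exact (leq_trans _ _ _ Hdq Hqr) |].
  exact K'.
Qed.

(** Stated for every extension of [p], so that it still applies to a common extension with another
    condition of [G]. *)
Lemma forces_mem_complete a b s r :
  a ∈ M -> b ∈ M -> opair s r ∈ b -> r ∈ G ->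
  (exists q, q ∈ G /\ fe q a s) -> 
  exists p, p ∈ G /\ forall d, d ∈ P -> d ≼ p -> fm d a b.
Proof.
  intros Ha Hb Hs Hr [q [Hq K]].
  destruct (G_common q r Hq Hr) as [p [Hp [Hpq Hpr]]].
  exists p. split; [exact Hp |]. intros d Hd Hdp.
  apply (forces_mem_intro _ _ _ _ s r Hs (leq_trans _ _ _ Hdp Hpr)).
  intros e He Hed. apply (forces_eq_le q); try assumption.
  - exact (name_M _ _ _ Hs Hb).
  - exact (leq_trans _ _ _ Hed (leq_trans _ _ _ Hdp Hpq)).
Qed.

(** Completeness for names in the two domains is a hypothesis, which lets the induction below use
    the lemma for both inclusions. *)
Lemma not_forces_not_incl p a b :
  p ∈ G -> a ∈ M -> b ∈ M -> val G a = val G b ->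
  (forall s t, in_dom s a -> in_dom t b -> val G s = val G t ->
     exists q, q ∈ G /\ fe q s t) ->
  ~ forces_not_incl p a b.
Proof.
  intros Hp Ha Hb E H [s [r [Hs [Hpr N]]]].
  assert (K : val G s ∈ val G b).
  { rewrite <- E. apply valP. exists s. split; [| reflexivity].
    exists r. split; [exact (G_up _ _ Hp Hpr) | exact Hs]. }
  apply valP in K. destruct K as [t [[r' [Hr' Ht]] Est]].
  destruct (forces_mem_complete s b t r') as [q [Hq K]]; try assumption.
  - exact (name_M _ _ _ Hs Ha).
  - apply H; [exists r | exists r' |]; assumption.
  - destruct (G_common p q Hp Hq) as [d [Hd [Hdp Hdq]]]. apply N.
    exists d. auto using G_P.
Qed.

(** Densely many conditions force the equality or refute one inclusion with an explicit name. A
    condition of [G] in this set cannot refute an inclusion when the values agree. *)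
Lemma forces_eq_complete a : a ∈ M -> forall b,
  b ∈ M -> val G a = val G b -> exists p, p ∈ G /\ fe p a b.
Proof.
  induction a as [a IH] using (well_founded_induction in_dom_wf).
  intros Ha b Hb E.
  assert (exists D, D ∈ M /\ forall p, p ∈ D <-> p ∈ P /\
    (fe p a b \/ forces_not_incl p a b \/ forces_not_incl p b a))
    as [D [HD KD]].
  { unfold forces_not_incl, forces_eq, forces_incl, forces_mem, dense_below.
    match goal with |- exists W, W ∈ M /\ forall z, _ <-> _ /\ @?Q z =>
      separate [P; leq; a; b] P Q end. }
  destruct (generic_meets D _ HD KD) as [p [Hp [K | [K | K]]]].
  - intros p Hp. destruct (classic (fi p a b)) as [Hab | N].
    + destruct (classic (fi p b a)) as [Hba | N].
      * exists p. auto using leq_refl, forces_eq_fold.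
      * apply not_forces_incl in N. destruct N as [q Hq]. exists q. tauto.
    + apply not_forces_incl in N. destruct N as [q Hq]. exists q. tauto.
  - eauto.
  - exfalso. revert K. apply not_forces_not_incl; try assumption.
    intros s t Hs [r Ht] Est. apply IH; try assumption.
    + destruct Hs as [r' Hs]. exact (name_M _ _ _ Hs Ha).
    + exact (name_M _ _ _ Ht Hb).
  - exfalso. revert K. apply not_forces_not_incl; try assumption; [auto |].
    intros s t [r Hs] Ht Est. pose proof (name_M _ _ _ Hs Hb) as HsM.
    assert (HtM : t ∈ M).
    { destruct Ht as [r' Ht]. exact (name_M _ _ _ Ht Ha). }
    destruct (IH t Ht HtM s HsM) as [q [Hq K]]; [auto |].
    exists q. split; [exact Hq |].
    apply forces_eq_sym; auto using G_P.
Qed.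

Lemma forces_eq_truth a b :
  a ∈ M -> b ∈ M -> (exists p, p ∈ G /\ fe p a b) <-> val G a = val G b.
Proof.
  intros Ha Hb. split.
  - intros [p [Hp K]]. exact (forces_eq_sound a Ha b p Hb Hp K).
  - exact (forces_eq_complete a Ha b Hb).
Qed.

Lemma forces_mem_truth a b :
  a ∈ M -> b ∈ M -> (exists p, p ∈ G /\ fm p a b) <-> val G a ∈ val G b.
Proof.
  intros Ha Hb. rewrite valP. split.
  - intros [p [Hp K]].
    destruct (forces_mem_generic p a b Hp Ha Hb K)
      as [q [s [r [Hq [Hr [Hs K']]]]]].
    exists s. split; [eauto |]. apply forces_eq_truth; eauto.
    exact (name_M _ _ _ Hs Hb).
  - intros [s [[r [Hr Hs]] E]].
    destruct (forces_mem_complete a b s r Ha Hb Hs Hr) as [p [Hp K]].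
    + apply forces_eq_complete; try assumption. exact (name_M _ _ _ Hs Hb).
    + exists p. auto using G_P, leq_refl.
Qed.

End Generic.
End Forcing.

(** * The forcing theorems *)

Lemma sat_atomic {V : ZF} (M : V) φ p P leq one ts i j :
  arity φ <= 6 ->
  sat M (p :: P :: leq :: one :: ts)
    (ren (fun n => match n with 4 => 4 + i | 5 => 4 + j | _ => n end) φ) <->
  sat M [p; P; leq; one; nth i ts empty; nth j ts empty] φ.
Proof.
  intro L. apply sat_ren. intros n Hn.
  do 6 (destruct n as [| n]; [reflexivity |]). lia.
Qed.

Lemma sat_skip {V : ZF} (M : V) φ q p env :
  sat M (q :: p :: env)
    (ren (fun n => match n with 0 => 0 | S k => S (S k) end) φ) <->
  sat M (q :: env) φ.
Proof. apply sat_ren. intros [| n] _; reflexivity. Qed.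

Lemma sat_move {V : ZF} (M : V) φ t p P leq one ts :
  sat M (t :: p :: P :: leq :: one :: ts)
    (ren (fun n => if n <? 4 then S n else if n =? 4 then 0 else n) φ) <->
  sat M (p :: P :: leq :: one :: t :: ts) φ.
Proof.
  apply sat_ren. intros n _.
  do 5 (destruct n as [| n]; [reflexivity |]). reflexivity.
Qed.

Lemma arity_forces eqf memf φ :
  arity eqf <= 6 -> arity memf <= 6 ->
  arity (forces_rec eqf memf φ) <= arity φ + 4.
Proof.
  intros He Hm.
  induction φ as [i j | i j | φ IHφ ψ IHψ | φ IHφ]; cbn [forces_rec].
  - apply arity_ren. intros n Hn. simpl arity.
    do 6 (destruct n as [| n]; [lia |]). lia.
  - apply arity_ren. intros n Hn. simpl arity.
    do 6 (destruct n as [| n]; [lia |]). lia.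
  - change (arity (fNand φ ψ)) with (Nat.max (arity φ) (arity ψ)).
    unfold fLeq. bound_arity; apply arity_ren; intros [| n]; lia.
  - apply arity_all. change (arity (fAll φ)) with (Nat.pred (arity φ)).
    apply arity_ren. intros n Hn.
    destruct (Nat.ltb_spec n 4); [lia |].
    destruct (Nat.eqb_spec n 4); lia.
Qed.

(** * Density and truth for all formulas *)

Section Translation.
Context {V : ZF} (M P leq one : V) (HM : transitive_model M []).
Context (χ : formula) (Hχ : union_iterates_kind χ).
Context (HR : sat M [] (Replacement χ)).
Context (HF : forcing_notion P leq one) (HP : P ∈ M) (Hleq : leq ∈ M).
Context (eqf memf : formula) (Leq : arity eqf <= 6) (Lmem : arity memf <= 6).
Context (Heq : forall p a b, p ∈ M -> a ∈ M -> b ∈ M ->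
  sat M [p; P; leq; one; a; b] eqf <-> forces_eq M P leq p a b).
Context (Hmem : forall p a b, p ∈ M -> a ∈ M -> b ∈ M ->
  sat M [p; P; leq; one; a; b] memf <->
  forces_mem P leq (forces_eq M P leq) p a b).

Local Notation "q ≼ p" := (opair q p ∈ leq) (at level 70).
Local Notation names := (Forall (fun t => t ∈ M)).

Definition forced p φ ts : Prop :=
  sat M (p :: P :: leq :: one :: ts) (forces_rec eqf memf φ).

Lemma forced_eq p i j ts :
  p ∈ P -> names ts ->
  forced p (fEq i j) ts <->
  forces_eq M P leq p (nth i ts empty) (nth j ts empty).
Proof.
  intros Hp Hts. unfold forced. cbn [forces_rec].
  rewrite sat_atomic, Heq by
    (try apply (nth_M M HM); try assumption; inM). reflexivity.
Qed.

Lemma forced_mem p i j ts :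
  p ∈ P -> names ts ->
  forced p (fMem i j) ts <->
  forces_mem P leq (forces_eq M P leq) p (nth i ts empty) (nth j ts empty).
Proof.
  intros Hp Hts. unfold forced. cbn [forces_rec].
  rewrite sat_atomic, Hmem by
    (try apply (nth_M M HM); try assumption; inM). reflexivity.
Qed.

Lemma forced_nand p φ ψ ts :
  p ∈ P ->
  forced p (fNand φ ψ) ts <->
  ~ exists q, q ∈ P /\ q ≼ p /\ forced q φ ts /\ forced q ψ ts.
Proof.
  intros Hp. unfold forced. cbn [forces_rec]. rewrite sat_not, sat_ex.
  assert (E : forall q, q ∈ M ->
    sat M (q :: p :: P :: leq :: one :: ts) (fLeq 0 1 3) <-> q ≼ p).
  { intros q Hq. rewrite (sat_leq M HM); simpl; [reflexivity | inM ..]. }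
  split; intros N [q K]; apply N; exists q.
  - assert (HqM : q ∈ M) by (destruct K; inM). split; [exact HqM |].
    rewrite !sat_and, E, !sat_skip by exact HqM. exact K.
  - destruct K as [HqM K]. rewrite !sat_and, E, !sat_skip in K by exact HqM.
    exact K.
Qed.

Lemma forced_all p φ ts :
  forced p (fAll φ) ts <-> forall t, t ∈ M -> forced p φ (t :: ts).
Proof.
  unfold forced. cbn [forces_rec]. simpl sat at 1. split; intros H t Ht.
  - apply sat_move. exact (H t Ht).
  - apply sat_move. exact (H t Ht).
Qed.

Lemma forced_relation : is_forcing_relation M P leq forced.
Proof.
  intros p ts Hp Hts.
  assert (N : forall i, nth i ts empty ∈ M) by (intro; apply nth_M; assumption).
  split; [| split; [| split]].
  - intros i j Hi Hj t1 t2. rewrite forced_eq by assumption.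
    rewrite (forces_eq_iff M P leq one HM χ Hχ HR HF)
      by (try assumption; apply N).
    fold t1 t2.
    assert (E : forall s q, in_dom s t1 \/ in_dom s t2 -> q ∈ P ->
      (forced q (fMem 0 1) [s; t1] <->
       forces_mem P leq (forces_eq M P leq) q s t1) /\
      (forced q (fMem 0 1) [s; t2] <->
       forces_mem P leq (forces_eq M P leq) q s t2)).
    { intros s q Hs Hq. pose proof (N i : t1 ∈ M). pose proof (N j : t2 ∈ M).
      assert (s ∈ M) by (destruct Hs as [[r Hs] | [r Hs]]; inM).
      split; apply (forced_mem q 0 1 [s; _]); auto. }
    split; intros H s q Hs Hq Hqp; destruct (E s q Hs Hq) as [E1 E2];
      [rewrite E1, E2 | rewrite <- E1, <- E2]; auto.
  - intros i j Hi Hj t1 t2. rewrite forced_mem by assumption. fold t1 t2.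
    pose proof (N i : t1 ∈ M). pose proof (N j : t2 ∈ M).
    assert (E : forall q s r, q ∈ P -> opair s r ∈ t2 ->
      (forced q (fEq 0 1) [t1; s] <-> forces_eq M P leq q t1 s)).
    { intros q s r Hq Hs. assert (s ∈ M) by inM.
      apply (forced_eq q 0 1 [t1; s]); auto. }
    (* Seen this way, both sides are [forces_mem] for two versions of forced equality, and
       monotonicity in that parameter gives each direction. *)
    change (forces_mem P leq (forces_eq M P leq) p t1 t2 <->
      forces_mem P leq (fun q t s => forced q (fEq 0 1) [t; s]) p t1 t2).
    split; apply forces_mem_impl; intros q s r Hq _ Hs; eapply E; eauto.
  - intros φ ψ _. apply forced_nand, Hp.
  - intros φ _. apply forced_all.
Qed.

(** For [fNand], density rests on monotonicity of the components: an extension forcing both would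
    pass this on to the condition [d] below it, which forces the [fNand]. *)
Lemma forced_le_and_dense φ : forall ts, names ts ->
  (forall p q, q ∈ P -> q ≼ p -> forced p φ ts -> forced q φ ts) /\
  (forall p, p ∈ P ->
     (forall q, q ∈ P -> q ≼ p -> exists d, d ∈ P /\ d ≼ q /\ forced d φ ts) ->
     forced p φ ts).
Proof.
  pose proof (leq_trans P leq one HF) as Tr.
  pose proof (leq_refl P leq one HF) as Rf.
  assert (Pr : forall p q, q ≼ p -> p ∈ P)
    by (intros p q; apply (leq_r P leq one HF)).
  induction φ as [i j | i j | φ IHφ ψ IHψ | φ IHφ]; intros ts Hts.
  - split.
    + intros p q Hq Hqp. rewrite !forced_mem by eauto.
      apply (forces_mem_le P leq one HF), Hqp.
    + intros p Hp H. rewrite forced_mem by assumption.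
      apply (forces_mem_dense P leq one HF). intros q Hq Hqp.
      destruct (H q Hq Hqp) as [d [Hd [Hdq K]]].
      rewrite forced_mem in K by assumption. eauto.
  - split.
    + intros p q Hq Hqp. rewrite !forced_eq by eauto.
      apply (forces_eq_le M P leq one HM χ Hχ HR HF); auto using nth_M.
    + intros p Hp H. rewrite forced_eq by assumption.
      apply (forces_eq_dense M P leq one HM χ Hχ HR HF); auto using nth_M.
      intros q Hq Hqp.
      destruct (H q Hq Hqp) as [d [Hd [Hdq K]]].
      rewrite forced_eq in K by assumption. eauto.
  - split.
    + intros p q Hq Hqp. rewrite !forced_nand by eauto.
      intros N [d [Hd [Hdq K]]]. apply N. exists d. eauto.
    + intros p Hp H. rewrite forced_nand by assumption.
      intros [q [Hq [Hqp [Kφ Kψ]]]]. destruct (H q Hq Hqp) as [d [Hd [Hdq K]]].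
      rewrite forced_nand in K by assumption. apply K. exists d.
      split; [exact Hd |]. split; [exact (Rf d Hd) |]. split.
      * exact (proj1 (IHφ ts Hts) q d Hd Hdq Kφ).
      * exact (proj1 (IHψ ts Hts) q d Hd Hdq Kψ).
  - split.
    + intros p q Hq Hqp. rewrite !forced_all. intros H t Ht.
      apply (proj1 (IHφ (t :: ts) (Forall_cons t Ht Hts)) p); auto.
    + intros p Hp H. apply forced_all. intros t Ht.
      apply (proj2 (IHφ (t :: ts) (Forall_cons t Ht Hts)) p Hp).
      intros q Hq Hqp. destruct (H q Hq Hqp) as [d [Hd [Hdq K]]].
      exists d. split; [exact Hd |]. split; [exact Hdq |].
      exact (proj1 (forced_all _ _ _) K t Ht).
Qed.

Lemma forced_le φ ts p q :
  names ts -> q ∈ P -> q ≼ p -> forced p φ ts -> forced q φ ts.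
Proof. intro Hts. apply (forced_le_and_dense φ ts Hts). Qed.

Lemma forced_dense φ ts p :
  names ts -> p ∈ P ->
  forced p φ ts <-> dense_below P leq p (fun q => q ∈ P /\ forced q φ ts).
Proof.
  intros Hts Hp. split.
  - intros H q Hq Hqp. exists q. split; [| apply (leq_refl P leq one HF), Hq].
    split; [exact Hq |]. exact (forced_le φ ts p q Hts Hq Hqp H).
  - intro H. apply (forced_le_and_dense φ ts Hts); [exact Hp |].
    intros q Hq Hqp. destruct (H q Hq Hqp) as [d [[Hd K] Hdq]]. eauto.
Qed.

Lemma forced_truth G φ : generic_filter M P leq G ->
  forall ts, names ts -> arity φ <= length ts ->
  (exists p, p ∈ G /\ forced p φ ts) <->
  sat (gen_ext M G) (map (val G) ts) φ.
Proof.
  intro HG.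
  pose proof (leq_trans P leq one HF) as Tr.
  pose proof (leq_refl P leq one HF) as Rf.
  assert (GP : forall p, p ∈ G -> p ∈ P) by apply HG.
  assert (HoneM : one ∈ M).
  { apply (M_trans M HM _ _ (proj1 (proj2 (proj2 (proj2 HF)))) HP). }
  assert (Nth : forall ts i, i < length ts ->
    nth i (map (val G) ts) empty = val G (nth i ts empty)).
  { intros ts i Hi. rewrite nth_indep with (d' := val G empty)
      by (rewrite length_map; exact Hi). apply map_nth. }
  induction φ as [i j | i j | φ IHφ ψ IHψ | φ IHφ]; intros ts Hts L;
    simpl in L.
  - simpl sat. rewrite !Nth by lia.
    rewrite <- (forces_mem_truth M P leq one HM χ Hχ HR HF HP Hleq G HG)
      by (apply nth_M; assumption).
    split; intros [p [Hp K]]; exists p; apply forced_mem in K || idtac;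
      try apply forced_mem; auto.
  - simpl sat. rewrite !Nth by lia.
    rewrite <- (forces_eq_truth M P leq one HM χ Hχ HR HF HP Hleq G HG)
      by (apply nth_M; assumption).
    split; intros [p [Hp K]]; exists p; apply forced_eq in K || idtac;
      try apply forced_eq; auto.
  - cbn [sat]. rewrite <- IHφ, <- IHψ by (assumption || lia). split.
    + intros [p [Hp K]] [[q [Hq Kφ]] [r [Hr Kψ]]].
      rewrite forced_nand in K by auto.
      destruct (G_common M P leq G HG p q Hp Hq) as [d [Hd [Hdp Hdq]]].
      destruct (G_common M P leq G HG d r Hd Hr) as [e [He [Hed Her]]].
      apply K. exists e. split; [auto |]. split; [eauto |].
      split; [apply (forced_le φ ts q) | apply (forced_le ψ ts r)]; eauto.
    + intro N.
      (* The set of conditions deciding the conjunction. It is dense because a condition with no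
         extension forcing both components forces the [fNand]. *)
      destruct (separation_M M HM (fOr (forces_rec eqf memf (fNand φ ψ))
          (fAnd (forces_rec eqf memf φ) (forces_rec eqf memf ψ)))
        (P :: leq :: one :: ts) P (fun p => forced p (fNand φ ψ) ts \/
          (forced p φ ts /\ forced p ψ ts))) as [D [HD KD]].
      * exact HP.
      * auto.
      * intros p _. rewrite sat_or, sat_and. reflexivity.
      * destruct (generic_meets M P leq G HG D _ HD KD)
          as [p [Hp [K | [Kφ Kψ]]]]; 
          [| exists p; auto | destruct N; split; exists p; auto].
        intros p Hp. destruct (classic (exists q, q ∈ P /\ q ≼ p /\
          forced q φ ts /\ forced q ψ ts)) as [[q K] | K].
        -- exists q. tauto.
        -- exists p. split; [exact Hp |]. split; [exact (Rf p Hp) |]. left.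
           apply forced_nand; assumption.
  - simpl sat. split.
    + intros [p [Hp K]] x Hx. apply gen_extP in Hx. destruct Hx as [t [Ht ->]].
      apply (IHφ (t :: ts)); [auto | simpl; lia |]. exists p.
      split; [exact Hp |]. exact (proj1 (forced_all _ _ _) K t Ht).
    + intro H.
      (* Conditions that force the universal formula or, as [fNand φ φ] is the negation of [φ],
         force a counterexample [t]. The renaming moves the bound [t] to position 4. *)
      destruct (separation_M M HM (fOr (forces_rec eqf memf (fAll φ))
          (fEx (ren (fun n => if n <? 4 then S n else if n =? 4 then 0 else n)
            (forces_rec eqf memf (fNand φ φ)))))
        (P :: leq :: one :: ts) P (fun p => forced p (fAll φ) ts \/
          exists t, t ∈ M /\ forced p (fNand φ φ) (t :: ts))) as [D [HD KD]].
      * exact HP.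
      * auto.
      * intros p _. rewrite sat_or, sat_ex.
        apply or_iff_compat_l.
        split; intros [t [Ht K]]; exists t; (split; [exact Ht |]);
          [exact (proj1 (sat_move M _ t p P leq one ts) K) |
           exact (proj2 (sat_move M _ t p P leq one ts) K)].
      * destruct (generic_meets M P leq G HG D _ HD KD)
          as [p [Hp [K | [t [Ht K]]]]]; [| exists p; auto |].
        -- intros p Hp. destruct (classic (forced p (fAll φ) ts)) as [K | N].
           { exists p. auto. }
           rewrite forced_all in N. apply not_all_ex_not in N.
           destruct N as [t N]. apply imply_to_and in N. destruct N as [Ht N].
           assert (Hts' : names (t :: ts)) by auto.
           (* By density, a condition not forcing [φ] at [t] has an extension below which nothing
              forces it; that extension forces the negation. *)
           rewrite forced_dense in N by assumption.
           apply NNPP. intro N'. apply N. intros q Hq Hqp.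
           apply NNPP. intro Nq. apply N'. exists q.
           split; [exact Hq |]. split; [exact Hqp |]. right. exists t.
           split; [exact Ht |]. apply forced_nand; [exact Hq |].
           intros [d [Hd [Hdq [K _]]]]. apply Nq. eauto.
        -- exfalso.
           destruct (proj2
             (IHφ (t :: ts) (Forall_cons t Ht Hts) ltac:(simpl; lia)))
             as [q [Hq Kq]].
           { apply (H (val G t)). apply gen_extP. eauto. }
           destruct (G_common M P leq G HG p q Hp Hq) as [d [Hd [Hdp Hdq]]].
           apply forced_nand in K; [| auto]. apply K. exists d.
           assert (forced d φ (t :: ts))
             by (apply (forced_le φ _ q); auto).
           auto.
Qed.

End Translation.

(** * Distinctness of the seven instances and the final assembly *)

Definition seven : list formula :=
  [proj1_sig union_iterates; proj1_sig union_recursion; proj1_sig rank;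
   proj1_sig cumulative; proj1_sig check_recursion; proj1_sig atomic_forcing;
   proj1_sig check_graph].

(** A branch of the syntax tree, leaving every seventh [fNand] through its first
    component.  Since [fNot] duplicates its argument, comparing the seven
    formulas directly is infeasible; this branch happens to differ in all of
    them. *)
Fixpoint branch (k : nat) (φ : formula) : list nat :=
  match φ with
  | fMem i j => [0; i; j]
  | fEq i j => [1; i; j]
  | fNand φ ψ => 2 :: match k with 0 => branch 6 φ | S k => branch k ψ end
  | fAll φ => 3 :: branch k φ
  end.

Lemma seven_NoDup : NoDup seven.
Proof.
  apply (NoDup_map_inv (branch 6)).
  (* As the seven branches differ, [nodup] evaluates to the list itself, and the general fact about
     [nodup] becomes the goal. *)
  assert (E : NoDup (nodup (list_eq_dec Nat.eq_dec) (map (branch 6) seven)))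
    by apply NoDup_nodup.
  vm_compute in E. vm_compute. exact E.
Qed.

Theorem theorem1 :
  exists (Θ : list formula) (forces : formula -> formula),
    seven_kinds Θ /\
    (exists feq fmem, forces = forces_rec feq fmem) /\
    forall (V : ZF) (M P leq one : V),
      countable_set M ->
      transitive_set M ->
      models M (Z_plus_Replacement Θ) ->
      forcing_notion P leq one ->
      P ∈ M ->
      leq ∈ M ->
      let forced (p : V) (φ : formula) (ts : list V) :=
        sat M (p :: P :: leq :: one :: ts) (forces φ) in
      is_forcing_relation M P leq forced /\
      forall (φ : formula) (n : nat) (ts : list V),
        arity φ <= n ->
        length ts = n ->
        Forall (fun t => t ∈ M) ts ->
        arity (forces φ) <= arity φ + 4 /\
        (forall G : V, generic_filter M P leq G ->
           ((exists p, p ∈ G /\ forced p φ ts) <->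
            sat (gen_ext M G) (map (val G) ts) φ)) /\
        (forall p, p ∈ P ->
           (forced p φ ts <->
            dense_below P leq p (fun q => q ∈ P /\ forced q φ ts))).
Proof.
  exists seven, (forces_rec (proj1_sig feq) (proj1_sig fmem)).
  split; [| split].
  - do 7 eexists. split; [reflexivity |]. split; [exact seven_NoDup |].
    exact (conj (proj2_sig union_iterates) (conj (proj2_sig union_recursion)
      (conj (proj2_sig rank) (conj (proj2_sig cumulative)
      (conj (proj2_sig check_recursion) (conj (proj2_sig atomic_forcing)
      (proj2_sig check_graph))))))).
  - eauto.
  - intros V M P leq one _ Htr Hmod HF HP Hleq.
    pose proof (conj Htr Hmod : transitive_model M seven) as HΘ.
    pose proof (Z_plus_replacement_mono M _ HΘ) as HM.
    pose proof (model_Replacement M _ _ HΘ (in_eq _ _)) as HR.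
    assert (H1 : one ∈ M) by exact
      (M_trans M HM _ _ (proj1 (proj2 (proj2 (proj2 HF)))) HP).
    destruct feq as [eqf [Leq Heq]], fmem as [memf [Lmem Hmem]].
    cbn [proj1_sig].
    assert (Heq' : forall p a b, p ∈ M -> a ∈ M -> b ∈ M ->
      sat M [p; P; leq; one; a; b] eqf <-> forces_eq M P leq p a b)
      by (intros; apply Heq; assumption).
    assert (Hmem' : forall p a b, p ∈ M -> a ∈ M -> b ∈ M ->
      sat M [p; P; leq; one; a; b] memf <->
      forces_mem P leq (forces_eq M P leq) p a b)
      by (intros; apply Hmem; assumption).
    pose proof (proj2_sig union_iterates) as Hχ. cbv beta in Hχ.
    (* From here on the formula is known only through its specification, so unification cannot
       unfold it. *)
    set (χ := proj1_sig union_iterates) in *. clearbody χ.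
    split; [exact (forced_relation M P leq one HM χ Hχ HR HF HP Hleq
      eqf memf Leq Lmem Heq' Hmem') |].
    intros φ n ts Ln <- Hts. split; [| split].
    + apply arity_forces; assumption.
    + intros G HG. exact (forced_truth M P leq one HM χ Hχ HR HF HP Hleq
        eqf memf Leq Lmem Heq' Hmem' G φ HG ts Hts Ln).
    + intros p Hp. exact (forced_dense M P leq one HM χ Hχ HR HF HP Hleq
        eqf memf Leq Lmem Heq' Hmem' φ ts p Hts Hp).
Qed.
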